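(* Let $\phi$ solve $-\Delta_5\phi=G$, $\phi|_{r=1}=0$, in the periodic cylinder $\{0<r<1,\ z\in\mathbb T\}$, and let $\sigma=-\partial_zu^z(1,0)=-\partial_z\partial_r\phi(1,0)$. Then, in the flattened coordinates $x=1-r$, $y=z$, the recovery kernel $K_\Omega$ for $\sigma$ has, inside every sufficiently small side-wall packet $\mathcal P_\lambda=\{0<x<\lambda,\ |y|<\lambda\}$, the local expansion $$K_\Omega(1-x,y)=C_0\frac{xy}{(x^2+y^2)^2}+K_{\rm rem}^{\lambda}(x,y),\qquad C_0>0.$$ On fixed cones $mx\le|y|\le Mx$ (with $0<m<M<\infty$), the remainder satisfies $$|K_{\rm rem}^{\lambda}(x,y)|\le C\lambda\frac{|xy|}{(x^2+y^2)^2}+K_{\rm smooth}^{\lambda}(x,y),$$ where $K_{\rm smooth}^\lambda$ is a smooth kernel, generated by periodic images, the axis, and global boundary corrections.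
   Context: $\Delta_5=\partial_r^2+\frac3r\partial_r+\partial_z^2$ (the Laplacian on $\mathbb R^4_Y\times\mathbb T_z$ acting on functions of $r=|Y|$ and $z$), and $\phi$ is regular at $r=0$ and periodic in $z$. The meridional velocity is recovered by $u^r=-r\partial_z\phi$, $u^z=2\phi+r\partial_r\phi$. The recovery (compression) kernel $K_\Omega(r,z)$ is the kernel representing $\sigma$ linearly in terms of $G$: $\sigma=\int K_\Omega(r,z)G(r,z)\,d\mu_5$ with $d\mu_5=r^3\,dr\,dz$. Equivalently it is obtained by applying $-\partial_z\partial_r$ at the boundary point $(r,z)=(1,0)$ to the Dirichlet Green function of $-\Delta_5$. *)

(* Defs.v *)
From Stdlib Require Import Reals.
From Coquelicot Require Import Coquelicot.
Open Scope R_scope.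

Definition smooth2 (f : R -> R -> R) : Prop :=
  forall (n : nat) (x y : R), ex_diff_n f n x y.

Definition Delta5 (phi : R -> R -> R) (r z : R) : R :=
  partial_derive 2 0 phi r z + 3 / r * partial_derive 1 0 phi r z
  + partial_derive 0 2 phi r z.

Definition uz (phi : R -> R -> R) (r z : R) : R :=
  2 * phi r z + r * Derive (fun s => phi s z) r.

Definition sigma (phi : R -> R -> R) : R :=
  - Derive (fun z => uz phi 1 z) 0.

Lemma sigma_dirichlet (phi : R -> R -> R) :
  (forall z, phi 1 z = 0) ->
  sigma phi = - Derive (fun z => Derive (fun r => phi r z) 1) 0.
Proof.
intros H; unfold sigma, uz; apply f_equal, Derive_ext; intros z.
rewrite H; ring.
Qed.

(* Classical solutions, smooth up to the boundary; the torus is R / LZ.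
   Smoothness up to the wall r = 1 is expressed by taking phi to be (the
   restriction of) a smooth function on the whole (r,z)-plane, and regularity
   at the axis (smoothness of (Y,z) |-> phi |Y| z) by evenness in r.  Neither
   Delta5 phi on 0 < r < 1 nor sigma phi depends on the extension to r > 1. *)
Definition dirichlet_solution (L : R) (phi G : R -> R -> R) : Prop :=
  smooth2 phi /\
  (forall r z, phi (- r) z = phi r z) /\
  (forall r z, phi r (z + L) = phi r z) /\
  (forall z, phi 1 z = 0) /\
  (forall r z, 0 < r < 1 -> - Delta5 phi r z = G r z).

(* The kernel K with  sigma = \int K G r^3 dr dz.  Its continuous
   representative on the open cylinder is selected.  K has a singularity of
   degree -2 at the point (1,0) of this two-dimensional domain, so K G is not
   absolutely integrable unless G(1,0) = 0; the integral is therefore the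
   limit of the integrals over the cylinders a < r < b as a -> 0+, b -> 1-.
   It is the Lebesgue integral whenever the latter exists. *)
Definition recovery_kernel (L : R) (K : R -> R -> R) : Prop :=
  (forall r z, 0 < r < 1 -> continuity_2d_pt K r z) /\
  (forall r z, 0 < r < 1 -> K r (z + L) = K r z) /\
  (forall phi G, dirichlet_solution L phi G ->
     is_RInt_gen
       (fun r => RInt (fun z => K r z * G r z * r ^ 3) (- (L / 2)) (L / 2))
       (at_right 0) (at_left 1) (sigma phi)).

Definition packet (lam x y : R) : Prop := 0 < x < lam /\ Rabs y < lam.

(* Main.v *)
Require Import Defs.
From Stdlib Require Import Reals.
From Coquelicot Require Import Coquelicot.
From Stdlib Require Import Factorial Lra Lia.
Open Scope R_scope.

(** The functional [sigma] is minus the tangential derivative, at the wall point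
    [(1,0)], of the normal derivative of [phi].  By Green's identity it is
    represented by the harmonic extension, for [Delta5], of minus the derivative
    of the Dirac mass at that point, that is by minus the [z]-derivative of the
    Poisson kernel.  In Fourier modes, with [k = 2 pi n / L],

      K(r,z) = (2/L) sum_n k f_k(r) sin(k z),   f_k(r) = I_1(k r) / (r I_1(k)).

    Local expansion.  Two integrating factors applied to Bessel's equation give
    [e^{-k(1-r)} <= f_k(r) <= e^{-k(1-r)} / r^2] ([profile_exp_bounds]).  If
    [f_k(1-x)] is replaced by [e^{-kx}], the series becomes the kernel of the
    periodic half-plane, which has a closed form ([is_series_n_sin]) equal to
    [(2/pi) x y / (x^2+y^2)^2] up to a bounded error.  The replacement costs
    [sum k x e^{-kx} = O(1/x)].  Hence the remainder is [O(1/x)] near the corner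
    ([recoveryK_expansion]); inside a cone [1/x] is comparable to
    [x |x y| / (x^2+y^2)^2] and [x < lam], which is the asserted bound, with
    zero as the smooth part: the images, the axis and the boundary corrections
    are all dominated by [1/x].

    Existence.  For a smooth solution [phi] with sine coefficients [s_n(r)], each
    mode of the pairing is the derivative of a multiple of
    [r^3 (f_k' s_n - f_k s_n')].  The coefficients decay faster than any power of
    [n], uniformly up to the wall, so the modes may be summed and integrated; at
    the wall they add up to minus the Fourier series at [z = 0] of the tangential
    derivative of [dr phi], which converges to that derivative
    ([fourier_inversion]).

    Uniqueness.  A kernel is tested only on right-hand sides that come from
    solutions smooth up to the wall.  For every mode, every shift [z0] and every
    shell of radii there is an explicit such solution whose right-hand side is a
    positive bump in the radius times [cos(k(z-z0))] ([test_solution]).  Therefore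
    all cosine coefficients about [z0] of the difference of two kernels vanish at
    each radius, and since the Poisson kernel is an approximate identity the
    difference vanishes at [z0] ([fourier_unique]). *)

(** * Series, integrals and elementary bounds *)

Lemma ex_series_bounded (a : nat -> R) (M : R) :
  (forall n, 0 <= a n) -> (forall n, sum_n a n <= M) ->
  ex_series a /\ 0 <= Series a <= M.
Proof.
intros Ha HM.
assert (Hex : ex_finite_lim_seq (sum_n a)).
{ apply ex_finite_lim_seq_incr with M; [|exact HM].
  intros n; rewrite sum_Sn; unfold plus; simpl; specialize (Ha (S n)); lra. }
destruct Hex as [l Hl].
assert (Hs : is_series a l) by exact Hl.
split; [exists l; exact Hs|].
rewrite (is_series_unique _ _ Hs); split.
- assert (H := is_lim_seq_le (fun _ => 0) (sum_n a) 0 l).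
  apply H; [|apply is_lim_seq_const|exact Hl].
  intros n; induction n as [|n IH].
  + rewrite sum_O; apply Ha.
  + rewrite sum_Sn; unfold plus; simpl; specialize (Ha (S n)); lra.
- assert (H := is_lim_seq_le (sum_n a) (fun _ => M) l M).
  apply H; [exact HM|exact Hl|apply is_lim_seq_const].
Qed.

Lemma ex_series_inv_sq : ex_series (fun n => / (INR n + 1) ^ 2).
Proof.
apply (ex_series_bounded _ 2).
- intros n; left; apply Rinv_0_lt_compat; generalize (pos_INR n); nra.
- intros n.
  assert (H : sum_n (fun n => / (INR n + 1) ^ 2) n <= 2 - / (INR n + 1)).
  { induction n as [|n IH].
    - rewrite sum_O; simpl; lra.
    - rewrite sum_Sn; unfold plus; simpl (AbelianMonoid.sort _) in *.
      rewrite S_INR; generalize (pos_INR n); intros Hn.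
      change (sum_n (fun n => / (INR n + 1) ^ 2) n
               + / (INR n + 1 + 1) ^ 2 <= 2 - / (INR n + 1 + 1)).
      assert (/ (INR n + 1 + 1) ^ 2 <= / (INR n + 1) - / (INR n + 1 + 1)); [|lra].
      replace (/ (INR n + 1) - / (INR n + 1 + 1))
        with (/ ((INR n + 1) * (INR n + 1 + 1))) by (field; lra).
      apply Rinv_le_contravar; nra. }
  assert (0 < / (INR n + 1)) by (apply Rinv_0_lt_compat; generalize (pos_INR n); lra).
  lra.
Qed.

Lemma ex_series_quad (C : R) (a : nat -> R) :
  (forall n, Rabs (a n) <= C / (INR n + 1) ^ 2) ->
  ex_series a.
Proof.
intros H.
apply (@ex_series_le R_AbsRing R_CompleteNormedModule a
         (fun n => C / (INR n + 1) ^ 2)); [exact H|].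
apply (@ex_series_scal R_AbsRing R_NormedModule C (fun n => / (INR n + 1) ^ 2)).
apply ex_series_inv_sq.
Qed.

Lemma ex_series_dominated (M a : nat -> R) :
  (forall n, Rabs (a n) <= M n) -> ex_series M ->
  ex_series a /\ Rabs (Series a) <= Series M.
Proof.
intros H HM.
assert (Habs : ex_series (fun n => Rabs (a n))).
{ apply (@ex_series_le R_AbsRing R_CompleteNormedModule _ M); [|exact HM].
  intros n; unfold norm; simpl; unfold abs; simpl; rewrite Rabs_Rabsolu; apply H. }
split; [apply ex_series_Rabs, Habs|].
eapply Rle_trans; [apply Series_Rabs, Habs|].
apply Series_le; [|exact HM].
intros n; split; [apply Rabs_pos|apply H].
Qed.

Lemma series_tail (M a : nat -> R) (N : nat) :
  (forall n, Rabs (a n) <= M n) -> ex_series M ->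
  Rabs (Series a - sum_n a N) <= Series M - sum_n M N.
Proof.
intros H HM.
assert (Ha := proj1 (ex_series_dominated M a H HM)).
rewrite (Series_incr_n a (S N)), (Series_incr_n M (S N)); [|lia|exact HM|lia|exact Ha].
simpl pred; rewrite <- !sum_n_Reals.
ring_simplify (sum_n a N + Series (fun k : nat => a (S N + k)%nat) - sum_n a N).
ring_simplify (sum_n M N + Series (fun k : nat => M (S N + k)%nat) - sum_n M N).
apply ex_series_dominated; [intros n; apply H|].
now apply (ex_series_incr_n M).
Qed.

(** The Weierstrass test for integrals.  Cutting the terms off outside [a,b]
    makes the domination global, hence the convergence uniform on the line,
    which is the setting of [filterlim_RInt]. *)
Lemma is_RInt_Series (u : nat -> R -> R) (M : nat -> R) (a b : R) :
  a <= b ->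
  (forall n x, a <= x <= b -> continuous (u n) x) ->
  (forall n x, a <= x <= b -> Rabs (u n x) <= M n) ->
  ex_series M ->
  is_RInt (fun x => Series (fun n => u n x)) a b
          (Series (fun n => RInt (u n) a b)).
Proof.
intros Hab Hc HM Hs.
set (v := fun n x => if Rle_dec a x then if Rle_dec x b then u n x else 0 else 0).
assert (Hin : forall n x, a <= x <= b -> v n x = u n x).
{ intros n x Hx; unfold v; destruct Rle_dec; [|lra]; destruct Rle_dec; [easy|lra]. }
assert (Hv : forall x n, Rabs (v n x) <= M n).
{ intros x n.
  assert (0 <= M n) by (eapply Rle_trans; [apply Rabs_pos|apply (HM n a); lra]).
  unfold v; destruct Rle_dec; [|now rewrite Rabs_R0];
    destruct Rle_dec; [apply HM; lra|now rewrite Rabs_R0]. }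
assert (Hex : forall n, is_RInt (u n) a b (RInt (u n) a b)).
{ intros n; apply (@RInt_correct R_CompleteNormedModule), (@ex_RInt_continuous R_CompleteNormedModule).
  intros x; rewrite Rmin_left, Rmax_right by lra; apply Hc. }
destruct (filterlim_RInt (fun N x => sum_n (fun n => v n x) N) a b eventually _
            (fun x => Series (fun n => v n x))
            (sum_n (fun n => RInt (u n) a b))) as [If [HIf HI]].
- intros N.
  apply is_RInt_ext with (fun x => sum_n (fun n => u n x) N).
  { intros x; rewrite Rmin_left, Rmax_right by lra; intros Hx.
    apply sum_n_ext; intros n; symmetry; apply Hin; lra. }
  induction N as [|N IH].
  + rewrite sum_O; apply is_RInt_ext with (u 0%nat); [|apply Hex].
    intros x _; now rewrite sum_O.
  + rewrite sum_Sn.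
    apply is_RInt_ext with (fun x => plus (sum_n (fun n => u n x) N) (u (S N) x)).
    { intros x _; now rewrite sum_Sn. }
    now apply (@is_RInt_plus R_NormedModule).
- apply filterlim_locally; intros eps.
  destruct Hs as [l Hl].
  assert (Hl' := proj1 (filterlim_locally _ _) Hl eps).
  revert Hl'; apply filter_imp; intros N HN x.
  assert (Hl2 : is_series M l) by exact Hl.
  assert (Ht := series_tail M (fun n => v n x) N (Hv x) (ex_intro _ l Hl2)).
  rewrite (is_series_unique _ _ Hl2) in Ht.
  unfold ball in HN |- *; simpl in HN |- *; unfold AbsRing_ball, abs, minus, plus, opp in HN |- *;
    simpl in HN |- *.
  apply Rabs_def2 in HN.
  rewrite <- Rabs_Ropp.
  eapply Rle_lt_trans; [|apply (Rle_lt_trans _ _ _ Ht)].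
  + right; f_equal; ring.
  + assert (HN2 : - eps < sum_n M N - l) by apply HN; lra.
- assert (Hser : is_series (fun n => RInt (u n) a b) If) by exact HIf.
  rewrite (is_series_unique _ _ Hser).
  apply is_RInt_ext with (2 := HI).
  intros x; rewrite Rmin_left, Rmax_right by lra; intros Hx.
  apply Series_ext; intros n; apply Hin; lra.
Qed.

Lemma continuous_of_2d (f : R -> R -> R) (x y : R) :
  continuity_2d_pt f x y -> continuous (fun z => f x z) y.
Proof.
intros H; apply continuity_pt_filterlim; intros eps Heps.
destruct (H (mkposreal eps Heps)) as [d Hd].
exists d; split; [apply cond_pos|].
intros z [_ Hz]; unfold dist in *; simpl in *; unfold R_dist in *.
apply Hd; [rewrite Rminus_diag; rewrite Rabs_R0; apply cond_pos|exact Hz].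
Qed.

Lemma ex_RInt_of_2d (f : R -> R -> R) (x a b : R) :
  (forall t, continuity_2d_pt f x t) -> ex_RInt (fun t => f x t) a b.
Proof.
intros H; apply (@ex_RInt_continuous R_CompleteNormedModule).
intros z _; now apply continuous_of_2d.
Qed.

Lemma continuous_RInt_param (f : R -> R -> R) (a b x : R) :
  a < b ->
  locally x (fun y => forall t, continuity_2d_pt f y t) ->
  continuous (fun y => RInt (fun t => f y t) a b) x.
Proof.
intros Hab Hloc.
assert (Hx := locally_singleton _ _ Hloc); simpl in Hx.
apply continuity_pt_filterlim; intros eps Heps.
assert (He : 0 < eps / (2 * (b - a))).
{ apply Rdiv_lt_0_compat; nra. }
destruct (uniform_continuity_2d_1d' f a b x (fun t _ => Hx t) (mkposreal _ He)) as [d Hd].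
destruct Hloc as [d' Hloc].
exists (Rmin d d'); split.
{ apply Rmin_pos; apply cond_pos. }
intros y [_ Hy]; unfold dist in *; simpl in *; unfold R_dist in *.
assert (Hy1 := Rlt_le_trans _ _ _ Hy (Rmin_l _ _)).
assert (Hy2 := Rlt_le_trans _ _ _ Hy (Rmin_r _ _)).
assert (E1 : ex_RInt (fun t => f y t) a b).
{ apply ex_RInt_of_2d, Hloc; exact Hy2. }
assert (E2 : ex_RInt (fun t => f x t) a b) by now apply ex_RInt_of_2d.
change (Rabs (RInt (fun t => f y t) a b - RInt (fun t => f x t) a b) < eps).
rewrite <- (RInt_minus (fun t => f y t) (fun t => f x t)) by assumption.
eapply Rle_lt_trans;
  [apply abs_RInt_le_const with (M := eps / (2 * (b - a))); [lra| |]|].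
- now apply @ex_RInt_minus.
- intros t Ht; left.
  assert (Hdp := cond_pos d).
  apply (Hd t x t y); [lra|lra|lra| |].
  + apply Rabs_def2 in Hy1; lra.
  + now rewrite Rminus_diag, Rabs_R0.
- replace ((b - a) * (eps / (2 * (b - a)))) with (eps / 2) by (field; lra); lra.
Qed.

(** [e^y = (e^{y/N})^N] and [e^{y/N} >= y/N]. *)
Lemma pow_le_exp (N : nat) (y : R) : (0 < N)%nat -> 0 <= y -> y ^ N <= INR N ^ N * exp y.
Proof.
intros HN Hy.
assert (H0 : 0 < INR N) by now apply lt_0_INR.
assert (H : exp y = exp (y / INR N) ^ N).
{ replace y with (INR N * (y / INR N)) at 1 by (field; lra).
  clear; generalize (y / INR N); intros t; induction N as [|N IH].
  - simpl; now rewrite Rmult_0_l, exp_0.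
  - rewrite S_INR, Rmult_plus_distr_r, exp_plus, IH, Rmult_1_l; simpl; ring. }
rewrite H, <- Rpow_mult_distr.
apply pow_incr; split; [lra|].
assert (H1 := exp_ineq1_le (y / INR N)).
apply Rle_trans with (INR N * (y / INR N)); [right; field; lra|].
apply Rmult_le_compat_l; lra.
Qed.

(** * The radial modes *)

Lemma le_of_derive (f f' : R -> R) (a b : R) :
  a <= b ->
  (forall x, a <= x <= b -> is_derive f x (f' x)) ->
  (forall x, a <= x <= b -> 0 <= f' x) -> f a <= f b.
Proof.
intros Hab Hd Hp.
destruct (MVT_gen f a b f') as [c [Hc E]].
- intros x; rewrite Rmin_left, Rmax_right by lra; intros Hx; apply Hd; lra.
- intros x; rewrite Rmin_left, Rmax_right by lra; intros Hx.
  apply continuity_pt_filterlim, (@ex_derive_continuous R_AbsRing R_NormedModule).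
  exists (f' x); apply Hd; lra.
- rewrite Rmin_left, Rmax_right in Hc by lra.
  specialize (Hp c Hc); nra.
Qed.

Definition bessel_coef (n : nat) : R := / (INR (fact n) * INR (fact (S n))).
(** [besselF t] is [I_1(2 sqrt t) / sqrt t], entire in [t]. *)
Definition besselF : R -> R := PSeries bessel_coef.
Definition besselF1 : R -> R := PSeries (PS_derive bessel_coef).

Lemma bessel_coef_pos n : 0 < bessel_coef n.
Proof.
apply Rinv_0_lt_compat, Rmult_lt_0_compat; apply INR_fact_lt_0.
Qed.

Lemma bessel_coef_S n : bessel_coef (S n) * ((INR n + 1) * (INR n + 2)) = bessel_coef n.
Proof.
unfold bessel_coef.
replace (fact (S (S n))) with (S (S n) * fact (S n))%nat by reflexivity.
replace (fact (S n)) with (S n * fact n)%nat by reflexivity.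
rewrite !mult_INR, !S_INR.
assert (H := INR_fact_lt_0 n); assert (H1 := pos_INR n).
field; repeat split; lra.
Qed.

Lemma bessel_coef_radius : CV_radius bessel_coef = p_infty.
Proof.
apply CV_radius_infinite_DAlembert.
{ intros n; generalize (bessel_coef_pos n); lra. }
apply is_lim_seq_le_le with (fun _ => 0) (fun n => / (INR n + 1)).
- intros n; assert (H1 := pos_INR n); split; [apply Rabs_pos|].
  rewrite <- (bessel_coef_S n).
  assert (Hp := bessel_coef_pos (S n)).
  replace (bessel_coef (S n) / (bessel_coef (S n) * ((INR n + 1) * (INR n + 2))))
    with (/ ((INR n + 1) * (INR n + 2))) by (field; lra).
  rewrite Rabs_pos_eq; [apply Rinv_le_contravar; nra|].
  left; apply Rinv_0_lt_compat; nra.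
- apply is_lim_seq_const.
- apply is_lim_seq_ext with (fun n => / INR (S n)).
  { intros n; now rewrite S_INR. }
  apply -> (is_lim_seq_incr_1 (fun n => / INR n)).
  replace (Finite 0) with (Rbar_inv p_infty) by reflexivity.
  apply is_lim_seq_inv; [apply is_lim_seq_INR|easy].
Qed.

Lemma PSeries_ge_0 (a : nat -> R) (t : R) :
  CV_radius a = p_infty -> (forall n, 0 <= a n) -> 0 <= t -> a 0%nat <= PSeries a t.
Proof.
intros Hr Ha Ht.
assert (Hex : ex_series (fun n => a n * t ^ n)).
{ apply ex_series_Rabs, CV_disk_inside; rewrite Hr; exact I. }
unfold PSeries; rewrite Series_incr_1 by exact Hex.
simpl; rewrite Rmult_1_r.
assert (H : 0 <= Series (fun n => a (S n) * (t * t ^ n))); [|lra].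
rewrite <- (Rmult_0_l (Series (fun n => a (S n) * (t * t ^ n)))), <- Series_scal_l.
apply Series_le.
- intros n; specialize (Ha (S n)).
  assert (0 <= t * t ^ n) by (apply Rmult_le_pos; [lra|now apply pow_le]).
  nra.
- apply (ex_series_incr_1 (fun n => a n * t ^ n)); exact Hex.
Qed.

Lemma besselF_ge_1 t : 0 <= t -> 1 <= besselF t.
Proof.
intros Ht; replace 1 with (bessel_coef 0) by (unfold bessel_coef; simpl; field).
apply PSeries_ge_0; [apply bessel_coef_radius| |exact Ht].
intros n; left; apply bessel_coef_pos.
Qed.

Lemma besselF1_ge_0 t : 0 <= t -> 0 <= besselF1 t.
Proof.
intros Ht.
assert (Hp : forall n, 0 <= PS_derive bessel_coef n).
{ intros n; unfold PS_derive; apply Rmult_le_pos; [apply pos_INR|left; apply bessel_coef_pos]. }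
eapply Rle_trans; [apply (Hp 0%nat)|].
apply PSeries_ge_0; [rewrite CV_radius_derive; apply bessel_coef_radius|exact Hp|exact Ht].
Qed.

Lemma is_derive_besselF t : is_derive besselF t (besselF1 t).
Proof. apply is_derive_PSeries; rewrite bessel_coef_radius; exact I. Qed.

(** Bessel's equation in the variable [t = s^2 / 4], where it has polynomial
    coefficients; on power series it is the recurrence [bessel_coef_S]. *)
Lemma besselF_ode t :
  exists F2, is_derive besselF1 t F2 /\ t * F2 + 2 * besselF1 t = besselF t.
Proof.
exists (PSeries (PS_derive (PS_derive bessel_coef)) t); split.
{ apply is_derive_PSeries; rewrite CV_radius_derive, bessel_coef_radius; exact I. }
assert (Hex : forall a, CV_radius a = p_infty -> ex_pseries a t).
{ intros a Ha; apply CV_radius_inside; rewrite Ha; exact I. }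
unfold besselF1, besselF.
rewrite <- PSeries_incr_1, <- PSeries_scal, <- PSeries_plus.
- apply PSeries_ext; intros n; unfold PS_plus, PS_scal, PS_incr_1, PS_derive.
  destruct n as [|n].
  + unfold plus, scal, zero, bessel_coef; simpl; unfold mult; simpl; field.
  + change (INR (S n) * (INR (S (S n)) * bessel_coef (S (S n)))
            + 2 * (INR (S (S n)) * bessel_coef (S (S n))) = bessel_coef (S n)).
    generalize (bessel_coef_S (S n)); rewrite !S_INR; intros H; rewrite <- H; ring.
- apply ex_pseries_incr_1, Hex; now rewrite !CV_radius_derive, bessel_coef_radius.
- apply ex_pseries_scal; [apply Rmult_comm|].
  apply Hex; now rewrite !CV_radius_derive, bessel_coef_radius.
Qed.

(** [besselU s] is [2 I_1(s) / s], the regular solution of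
    [U'' + 3 U'/s = U], and [besselV] is its derivative. *)
Definition besselU (s : R) : R := besselF (s ^ 2 / 4).
Definition besselV (s : R) : R := s / 2 * besselF1 (s ^ 2 / 4).

Lemma is_derive_besselU s : is_derive besselU s (besselV s).
Proof.
unfold besselU, besselV.
evar_last; [apply (is_derive_comp besselF (fun s => s ^ 2 / 4));
             [apply is_derive_besselF|auto_derive; [easy|reflexivity]]|].
unfold scal; simpl; unfold mult; simpl; field.
Qed.

Lemma is_derive_besselV s :
  is_derive besselV s (besselU s - 3 / 2 * besselF1 (s ^ 2 / 4)).
Proof.
destruct (besselF_ode (s ^ 2 / 4)) as [F2 [HF E]].
unfold besselV, besselU.
evar_last.
- apply (is_derive_mult (fun s => s / 2) (fun s => besselF1 (s ^ 2 / 4))).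
  + auto_derive; [easy|reflexivity].
  + apply (is_derive_comp besselF1 (fun s => s ^ 2 / 4)); [exact HF|].
    auto_derive; [easy|reflexivity].
  + apply Rmult_comm.
- unfold plus, mult, scal; simpl; unfold mult; simpl.
  simpl in E; rewrite <- E; field.
Qed.

Lemma besselV_eq s : 3 / 2 * besselF1 (s ^ 2 / 4) * s = 3 * besselV s.
Proof. unfold besselV; field. Qed.

Lemma besselU_ge_1 s : 1 <= besselU s.
Proof. apply besselF_ge_1; nra. Qed.

Lemma besselV_ge_0 s : 0 <= s -> 0 <= besselV s.
Proof.
intros Hs; apply Rmult_le_pos; [lra|apply besselF1_ge_0; nra].
Qed.

Lemma besselU_0 : besselU 0 = 1.
Proof.
unfold besselU, besselF; replace (0 ^ 2 / 4) with 0 by field.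
rewrite PSeries_0; unfold bessel_coef; simpl; field.
Qed.

(** The equation gives [(e^s (U - U'))' = 3 e^s U' / s >= 0], and [U - U'] is
    positive at [0]. *)
Lemma besselV_le_U s : 0 <= s -> besselV s <= besselU s.
Proof.
intros Hs.
assert (H : exp 0 * (besselU 0 - besselV 0) <= exp s * (besselU s - besselV s)).
{ apply (le_of_derive (fun s => exp s * (besselU s - besselV s))
           (fun s => exp s * (3 / 2 * besselF1 (s ^ 2 / 4)))); [exact Hs| |].
  - intros x Hx; evar_last.
    + apply (is_derive_mult exp (fun s => besselU s - besselV s)).
      * apply is_derive_exp.
      * apply (@is_derive_minus R_AbsRing R_NormedModule);
          [apply is_derive_besselU|apply is_derive_besselV].
      * apply Rmult_comm.
    + unfold minus, plus, opp, mult; simpl; ring.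
  - intros x Hx; apply Rmult_le_pos; [left; apply exp_pos|].
    assert (0 <= besselF1 (x ^ 2 / 4)) by (apply besselF1_ge_0; nra); lra. }
rewrite exp_0, besselU_0 in H; unfold besselV at 1 in H.
assert (He := exp_pos s).
destruct (Rle_dec (besselV s) (besselU s)); nra.
Qed.

(** The logarithmic derivative of [U] is at least [1 - 3/(2s)].  The constant
    [3/2] is the one for which [q = s U' - s U + 3/2 U] satisfies
    [(e^s q)' = e^s (U - U') / 2], nonnegative by the previous bound. *)
Lemma besselV_lower s : 0 <= s -> 0 <= s * besselV s - s * besselU s + 3 / 2 * besselU s.
Proof.
intros Hs.
set (q := fun s => s * besselV s - s * besselU s + 3 / 2 * besselU s).
assert (H : exp 0 * q 0 <= exp s * q s).
{ apply (le_of_derive (fun s => exp s * q s)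
           (fun s => exp s * ((besselU s - besselV s) / 2))); [exact Hs| |].
  - intros x Hx; unfold q; evar_last.
    + apply (is_derive_mult exp); [apply is_derive_exp| |apply Rmult_comm].
      apply (@is_derive_plus R_AbsRing R_NormedModule).
      * apply (@is_derive_minus R_AbsRing R_NormedModule).
        -- apply (is_derive_mult (fun s => s) besselV);
             [apply (@is_derive_id R_AbsRing)|apply is_derive_besselV|apply Rmult_comm].
        -- apply (is_derive_mult (fun s => s) besselU);
             [apply (@is_derive_id R_AbsRing)|apply is_derive_besselU|apply Rmult_comm].
      * apply is_derive_scal, is_derive_besselU.
    + unfold minus, plus, opp, mult, one; simpl.
      generalize (besselV_eq x); simpl; intros E.
      match goal with |- ?l = ?r => assert (E2 : l - r = exp x * (3 * besselV x - 3 / 2 * besselF1 (x * (x * 1) / 4) * x)) by field end.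
      rewrite E, Rminus_diag, Rmult_0_r in E2; lra.
  - intros x Hx; apply Rmult_le_pos; [left; apply exp_pos|].
    generalize (besselV_le_U x (proj1 Hx)); lra. }
rewrite exp_0 in H; unfold q in H at 1; rewrite besselU_0 in H.
assert (He := exp_pos s).
fold (q s); destruct (Rle_dec 0 (q s)); nra.
Qed.

(** The radial profile of the k-th Fourier mode of the Poisson kernel:
    the solution of [f'' + 3 f'/r = k^2 f], regular on the axis, [f(1) = 1]. *)
Definition profile (k r : R) : R := besselU (k * r) / besselU k.
Definition profile' (k r : R) : R := k * besselV (k * r) / besselU k.

Lemma is_derive_profile k r : is_derive (profile k) r (profile' k r).
Proof.
unfold profile, profile'.
assert (H := besselU_ge_1 k).
evar_last.
- apply (is_derive_ext (fun r => / besselU k * besselU (k * r))).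
  { intros t; simpl; field; lra. }
  apply is_derive_scal.
  apply (is_derive_comp besselU (fun r => k * r)); [apply is_derive_besselU|].
  auto_derive; [easy|reflexivity].
- unfold scal; simpl; unfold mult; simpl; field; lra.
Qed.

Lemma is_derive_r3_profile' k r :
  is_derive (fun r => r ^ 3 * profile' k r) r (k ^ 2 * r ^ 3 * profile k r).
Proof.
unfold profile, profile'.
assert (H := besselU_ge_1 k).
evar_last.
- apply (is_derive_ext (fun r => / besselU k * (k * r ^ 3 * besselV (k * r)))).
  { intros t; simpl; field; lra. }
  apply is_derive_scal.
  apply (is_derive_mult (fun r => k * r ^ 3) (fun r => besselV (k * r))).
  + auto_derive; [easy|reflexivity].
  + apply (is_derive_comp besselV (fun r => k * r)); [apply is_derive_besselV|].
    auto_derive; [easy|reflexivity].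
  + apply Rmult_comm.
- unfold plus, mult, scal; simpl; unfold mult; simpl.
  generalize (besselV_eq (k * r)).
  match goal with |- context [besselU (k * r) - 3 / 2 * besselF1 ?x] =>
    change x with ((k * r) ^ 2 / 4) end.
  generalize (besselF1 ((k * r) ^ 2 / 4)); intros b1 E.
  apply Rminus_diag_uniq; transitivity
    (/ besselU k * (r * r * k) * (3 * besselV (k * r) - 3 / 2 * b1 * (k * r)));
    [field; lra|rewrite E; ring].
Qed.

Lemma profile_1 k : profile k 1 = 1.
Proof. unfold profile; rewrite Rmult_1_r; field; generalize (besselU_ge_1 k); lra. Qed.

Lemma besselU_incr a b : 0 <= a <= b -> besselU a <= besselU b.
Proof.
intros H; apply (le_of_derive besselU besselV); [lra| |].
- intros x _; apply is_derive_besselU.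
- intros x Hx; apply besselV_ge_0; lra.
Qed.

Lemma profile_bounds k r : 0 <= k -> 0 <= r <= 1 -> 0 <= profile k r <= 1.
Proof.
intros Hk Hr; unfold profile.
assert (H1 := besselU_ge_1 k); assert (H2 := besselU_ge_1 (k * r)).
split; [apply Rle_div_r; lra|].
apply Rle_div_l; [lra|]; rewrite Rmult_1_l; apply besselU_incr; nra.
Qed.

(** The two bounds on the logarithmic derivative imply that [e^{-s} U(s)]
    decreases and [s^2 e^{-s} U(s)] increases ([s^{3/2}] would also do).  So a
    mode decays away from the wall exactly like the half-plane mode
    [e^{-k(1-r)}], up to a factor that tends to [1] at the wall uniformly in
    the frequency. *)
Lemma profile_exp_bounds k r : 0 <= k -> 0 < r <= 1 ->
  exp (- (k * (1 - r))) <= profile k r <= exp (- (k * (1 - r))) / r ^ 2.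
Proof.
intros Hk Hr; unfold profile.
assert (H1 := besselU_ge_1 k); assert (H2 := besselU_ge_1 (k * r)).
assert (Ek : exp (- (k * (1 - r))) = exp (k * r) * exp (- k)).
{ rewrite <- exp_plus; f_equal; ring. }
assert (Er : exp (k * r) * exp (- (k * r)) = 1).
{ rewrite <- exp_plus, Rplus_opp_r; apply exp_0. }
assert (Hder : forall x, is_derive (fun s => exp (- s) * besselU s) x
                  (exp (- x) * (besselV x - besselU x))).
{ intros x; evar_last.
  - apply (is_derive_mult (fun s => exp (- s)) besselU).
    + auto_derive; [easy|reflexivity].
    + apply is_derive_besselU.
    + apply Rmult_comm.
  - unfold plus, mult; simpl; ring. }
assert (P1 := exp_pos (k * r)); assert (P2 := exp_pos (- k)).
split.
- apply Rle_div_r; [lra|].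
  assert (A : - (exp (- (k * r)) * besselU (k * r)) <= - (exp (- k) * besselU k)).
  { apply (le_of_derive (fun s => - (exp (- s) * besselU s))
             (fun s => - (exp (- s) * (besselV s - besselU s)))); [nra| |].
    - intros x _; apply (@is_derive_opp R_AbsRing R_NormedModule), Hder.
    - intros x Hx; assert (0 <= x) by nra.
      generalize (besselV_le_U x H) (exp_pos (- x)); nra. }
  rewrite Ek.
  apply Rle_trans with (exp (k * r) * (exp (- (k * r)) * besselU (k * r))); [nra|].
  rewrite <- Rmult_assoc, Er; lra.
- destruct (Req_dec k 0) as [->|Hk0].
  { replace (0 * r) with 0 by ring.
    rewrite Rmult_0_l, Ropp_0, exp_0, besselU_0.
    replace (1 / 1) with 1 by field; apply Rle_div_r; simpl; nra. }
  assert (Hkp : 0 < k) by lra.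
  assert (Hkr : 0 < k * r) by nra.
  assert (A : (k * r) ^ 2 * (exp (- (k * r)) * besselU (k * r))
              <= k ^ 2 * (exp (- k) * besselU k)).
  { apply (le_of_derive (fun s => s ^ 2 * (exp (- s) * besselU s))
             (fun s => s * (exp (- s) * (2 * besselU s + s * besselV s - s * besselU s)))); [nra| |].
    - intros x _; evar_last.
      + apply (is_derive_mult (fun s => s ^ 2)); [auto_derive; [easy|reflexivity]|apply Hder|apply Rmult_comm].
      + unfold plus, mult; simpl; ring.
    - intros x Hx; assert (Hx0 : 0 <= x) by nra.
      generalize (besselV_lower x Hx0) (besselU_ge_1 x) (exp_pos (- x)); intros.
      apply Rmult_le_pos; [lra|]; apply Rmult_le_pos; lra. }
  rewrite Ek.
  apply Rle_div_l; [lra|].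
  replace (exp (k * r) * exp (- k) / r ^ 2 * besselU k)
    with ((exp (k * r) * (k ^ 2 * (exp (- k) * besselU k))) / (k * r) ^ 2) by (field; lra).
  apply Rle_div_r; [nra|].
  apply Rle_trans with (exp (k * r) * ((k * r) ^ 2 * (exp (- (k * r)) * besselU (k * r)))).
  + right.
    transitivity ((exp (k * r) * exp (- (k * r))) * ((k * r) ^ 2 * besselU (k * r))); [rewrite Er|]; ring.
  + apply Rmult_le_compat_l; lra.
Qed.

(** * Smooth functions of one and two variables *)

(** Carrying the derivative as a witness makes closure under products,
    inverses and composition a plain induction on the order. *)
Fixpoint Ck (n : nat) (f : R -> R) : Prop :=
  match n with
  | O => forall x, continuous f x
  | S n => exists f' : R -> R, (forall x, is_derive f x (f' x)) /\ Ck n f'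
  end.

Lemma Ck_pred n f : Ck (S n) f -> Ck n f.
Proof.
revert f; induction n as [|n IH]; intros f [f' [Hd Hf]].
- intros x; apply (@ex_derive_continuous R_AbsRing R_NormedModule); now exists (f' x).
- exists f'; split; [exact Hd|now apply IH].
Qed.

Lemma Ck_continuous n f : Ck n f -> forall x, continuous f x.
Proof.
revert f; induction n as [|n IH]; intros f H; [exact H|].
now apply IH, Ck_pred.
Qed.

Lemma Ck_ext n f g : (forall x, f x = g x) -> Ck n f -> Ck n g.
Proof.
intros E; destruct n as [|n].
- intros H x; now apply continuous_ext with f.
- intros [f' [Hd Hf]]; exists f'; split; [|exact Hf].
  intros x; now apply is_derive_ext with f.
Qed.

Lemma Ck_const n c : Ck n (fun _ => c).
Proof.
revert c; induction n as [|n IH]; intros c.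
- intros x; apply continuous_const.
- exists (fun _ => 0); split; [|apply IH].
  intros x; apply (@is_derive_const R_AbsRing R_NormedModule).
Qed.

Lemma Ck_id n : Ck n (fun x => x).
Proof.
destruct n as [|n].
- intros x; apply continuous_id.
- exists (fun _ => 1); split; [|apply Ck_const].
  intros x; apply (@is_derive_id R_AbsRing).
Qed.

Lemma Ck_plus n f g : Ck n f -> Ck n g -> Ck n (fun x => f x + g x).
Proof.
revert f g; induction n as [|n IH]; intros f g Hf Hg.
- intros x; apply (@continuous_plus R_UniformSpace R_AbsRing R_NormedModule); auto.
- destruct Hf as [f' [Df Hf]], Hg as [g' [Dg Hg]].
  exists (fun x => f' x + g' x); split; [|now apply IH].
  intros x; apply (@is_derive_plus R_AbsRing R_NormedModule); auto.
Qed.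

Lemma Ck_mult n f g : Ck n f -> Ck n g -> Ck n (fun x => f x * g x).
Proof.
revert f g; induction n as [|n IH]; intros f g Hf Hg.
- intros x; apply (@continuous_mult R_UniformSpace R_AbsRing); auto.
- assert (Cf := Ck_pred _ _ Hf); assert (Cg := Ck_pred _ _ Hg).
  destruct Hf as [f' [Df Hf]], Hg as [g' [Dg Hg]].
  exists (fun x => f' x * g x + f x * g' x); split.
  + intros x; apply (@is_derive_mult R_AbsRing); auto; apply Rmult_comm.
  + apply Ck_plus; apply IH; auto.
Qed.

Lemma Ck_scal n c f : Ck n f -> Ck n (fun x => c * f x).
Proof. intros H; apply Ck_mult; [apply Ck_const|exact H]. Qed.

Lemma Ck_pow n m f : Ck n f -> Ck n (fun x => f x ^ m).
Proof.
intros H; induction m as [|m IH]; [apply (Ck_const n 1)|].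
exact (Ck_mult n f (fun x => f x ^ m) H IH).
Qed.

Lemma Ck_comp n f g : Ck n f -> Ck n g -> Ck n (fun x => f (g x)).
Proof.
revert f g; induction n as [|n IH]; intros f g Hf Hg.
- intros x; apply (continuous_comp g f); auto.
- assert (Cg := Ck_pred _ _ Hg).
  destruct Hf as [f' [Df Hf]], Hg as [g' [Dg Hg]].
  exists (fun x => g' x * f' (g x)); split.
  + intros x; apply (@is_derive_comp R_AbsRing R_NormedModule f g); auto.
  + apply Ck_mult; auto.
Qed.

Lemma Ck_inv n f : (forall x, f x <> 0) -> Ck n f -> Ck n (fun x => / f x).
Proof.
revert f; induction n as [|n IH]; intros f H0 Hf.
- intros x; apply continuous_Rinv_comp; auto.
- assert (Cf := Ck_pred _ _ Hf).
  destruct Hf as [f' [Df Hf]].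
  exists (fun x => (-1) * (f' x * (/ f x) ^ 2)); split.
  + intros x; evar_last; [apply is_derive_inv; auto|field; auto].
  + apply Ck_scal, Ck_mult; [exact Hf|apply Ck_pow, IH; auto].
Qed.

Lemma Ck_primitive n f a : Ck n f -> Ck (S n) (fun x => RInt f a x).
Proof.
intros H; exists f; split; [|exact H].
assert (Hc := Ck_continuous _ _ H).
intros x; apply (is_derive_RInt f _ a x); [|apply Hc].
apply filter_forall; intros y; apply (@RInt_correct R_CompleteNormedModule).
apply (@ex_RInt_continuous R_CompleteNormedModule); intros; apply Hc.
Qed.

Lemma Ck_cos_sin n : Ck n cos /\ Ck n sin.
Proof.
induction n as [|n [IHc IHs]].
- split; intros x; [apply continuous_cos|apply continuous_sin].
- split.
  + exists (fun x => (-1) * sin x); split; [|now apply Ck_scal].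
    intros x; evar_last; [apply is_derive_cos|ring].
  + exists cos; split; [|exact IHc].
    intros x; apply is_derive_sin.
Qed.

Lemma Ck_PSeries n a : CV_radius a = p_infty -> Ck n (PSeries a).
Proof.
revert a; induction n as [|n IH]; intros a Ha.
- intros x; apply (@ex_derive_continuous R_AbsRing R_NormedModule).
  exists (PSeries (PS_derive a) x); apply is_derive_PSeries; rewrite Ha; exact I.
- exists (PSeries (PS_derive a)); split.
  + intros x; apply is_derive_PSeries; rewrite Ha; exact I.
  + apply IH; now rewrite CV_radius_derive.
Qed.

Lemma Ck_besselF n : Ck n besselF.
Proof. apply Ck_PSeries, bessel_coef_radius. Qed.

(** The functions [x^{-m} e^{-1/x}], extended by zero to [x <= 0], are
    differentiable with derivatives in their own span; this gives smoothness
    of the flat function [m = 0] by induction. *)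
Definition flat (m : nat) (x : R) : R :=
  if Rle_dec x 0 then 0 else (/ x) ^ m * exp (- / x).

Lemma flat_neg m x : x <= 0 -> flat m x = 0.
Proof. intros H; unfold flat; now destruct Rle_dec. Qed.

Lemma flat_pos m x : 0 < x -> flat m x = (/ x) ^ m * exp (- / x).
Proof. intros H; unfold flat; destruct Rle_dec; lra. Qed.

Lemma flat_quad m x : Rabs (flat m x) <= INR (m + 2) ^ (m + 2) * x ^ 2.
Proof.
assert (HI : 0 <= INR (m + 2) ^ (m + 2)) by (apply pow_le, pos_INR).
destruct (Rle_dec x 0) as [H|H].
- rewrite flat_neg by exact H; rewrite Rabs_R0; apply Rmult_le_pos; nra.
- assert (Hx : 0 < x) by lra.
  assert (Hi : 0 < / x) by now apply Rinv_0_lt_compat.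
  rewrite flat_pos by exact Hx.
  assert (Hp := exp_pos (- / x)).
  rewrite Rabs_pos_eq by (apply Rmult_le_pos; [apply pow_le|]; lra).
  assert (H1 := pow_le_exp (m + 2) (/ x) ltac:(lia) ltac:(lra)).
  rewrite pow_add in H1 at 1.
  assert (E : exp (/ x) * exp (- / x) = 1) by (rewrite <- exp_plus, Rplus_opp_r; apply exp_0).
  replace ((/ x) ^ m * exp (- / x)) with (((/ x) ^ m * (/ x) ^ 2) * exp (- / x) * x ^ 2) by (field; lra).
  apply Rmult_le_compat_r; [nra|].
  apply Rle_trans with (INR (m + 2) ^ (m + 2) * exp (/ x) * exp (- / x)); [nra|].
  rewrite Rmult_assoc, E; lra.
Qed.

Lemma is_derive_flat m x :
  is_derive (flat m) x (flat (S (S m)) x - INR m * flat (S m) x).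
Proof.
destruct (Rtotal_order x 0) as [H|[->|H]].
- rewrite !flat_neg by lra; replace (0 - INR m * 0) with 0 by ring.
  apply is_derive_ext_loc with (fun _ => 0); [|apply (@is_derive_const R_AbsRing R_NormedModule)].
  assert (Hd : 0 < - x) by lra.
  exists (mkposreal _ Hd); intros y Hy.
  unfold ball in Hy; simpl in Hy; unfold AbsRing_ball, abs, minus, plus, opp in Hy; simpl in Hy.
  apply Rabs_def2 in Hy; rewrite flat_neg; lra.
- rewrite !flat_neg by lra; replace (0 - INR m * 0) with 0 by ring.
  apply is_derive_Reals; intros eps Heps.
  set (C := INR (m + 2) ^ (m + 2)).
  assert (HC : 0 <= C) by (apply pow_le, pos_INR).
  assert (Hd : 0 < eps / (C + 1)) by (apply Rdiv_lt_0_compat; lra).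
  exists (mkposreal _ Hd); intros h Hh0 Hh; simpl in Hh.
  rewrite Rplus_0_l, (flat_neg m 0), !Rminus_0_r by lra.
  assert (Hq := flat_quad m h); fold C in Hq.
  unfold Rdiv; rewrite Rabs_mult, Rabs_inv.
  assert (Ha : 0 < Rabs h) by now apply Rabs_pos_lt.
  rewrite <- (pow2_abs h) in Hq.
  apply Rle_lt_trans with (C * Rabs h).
  + apply Rle_div_l; [lra|]; nra.
  + apply Rlt_div_r in Hh; nra.
- rewrite !flat_pos by exact H.
  apply is_derive_ext_loc with (fun x => (/ x) ^ m * exp (- / x)).
  { exists (mkposreal _ H); intros y Hy.
    unfold ball in Hy; simpl in Hy; unfold AbsRing_ball, abs, minus, plus, opp in Hy; simpl in Hy.
    apply Rabs_def2 in Hy; rewrite flat_pos; lra. }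
  auto_derive; [lra|].
  destruct m as [|m]; simpl; [|]; field; lra.
Qed.

Lemma Ck_flat n m : Ck n (flat m).
Proof.
revert m; induction n as [|n IH]; intros m.
- intros x; apply (@ex_derive_continuous R_AbsRing R_NormedModule).
  eexists; apply is_derive_flat.
- exists (fun x => flat (S (S m)) x + (- INR m) * flat (S m) x); split.
  + intros x; evar_last; [apply is_derive_flat|ring].
  + apply Ck_plus; [apply IH|apply Ck_scal, IH].
Qed.

Lemma flat0_pos x : 0 < x -> 0 < flat 0 x.
Proof. intros H; rewrite flat_pos by exact H; simpl; generalize (exp_pos (- / x)); lra. Qed.

Lemma flat0_nonneg x : 0 <= flat 0 x.
Proof.
destruct (Rle_dec x 0) as [H|H]; [rewrite flat_neg; lra|].
left; apply flat0_pos; lra.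
Qed.

Lemma continuity_2d_tensor (a b : R -> R) x y :
  continuous a x -> continuous b y -> continuity_2d_pt (fun u v => a u * b v) x y.
Proof.
intros Ha Hb.
apply continuity_2d_pt_mult.
- apply (continuity_1d_2d_pt_comp a (fun u _ => u));
    [now apply continuity_pt_filterlim|apply continuity_2d_pt_id1].
- apply (continuity_1d_2d_pt_comp b (fun _ v => v));
    [now apply continuity_pt_filterlim|apply continuity_2d_pt_id2].
Qed.

Lemma ex_diff_n_tensor n (a b : R -> R) x y :
  Ck n a -> Ck n b -> ex_diff_n (fun u v => a u * b v) n x y.
Proof.
revert a b; induction n as [|n IH]; intros a b Ha Hb.
- split; [|exact I]; apply continuity_2d_tensor; [apply Ha|apply Hb].
- assert (Ca := Ck_pred _ _ Ha); assert (Cb := Ck_pred _ _ Hb).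
  assert (Ka := Ck_continuous _ _ Ha); assert (Kb := Ck_continuous _ _ Hb).
  destruct Ha as [a' [Da Ha]], Hb as [b' [Db Hb]].
  assert (D1 : forall u v, is_derive (fun z => a z * b v) u (a' u * b v)).
  { intros u v; evar_last.
    - apply (@is_derive_mult R_AbsRing a (fun _ => b v));
        [apply Da|apply (@is_derive_const R_AbsRing R_NormedModule)|apply Rmult_comm].
    - unfold plus, mult, zero; simpl; ring. }
  assert (D2 : forall u v, is_derive (fun z => a u * b z) v (a u * b' v)).
  { intros u v; apply is_derive_scal, Db. }
  split; [now apply continuity_2d_tensor|].
  split; [eexists; apply D1|].
  split; [eexists; apply D2|].
  split.
  + apply ex_diff_n_ext_loc with (fun u v => a' u * b v); [|now apply IH].
    apply locally_2d_forall; intros u v; symmetry; apply is_derive_unique, D1.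
  + apply ex_diff_n_ext_loc with (fun u v => a u * b' v); [|now apply IH].
    apply locally_2d_forall; intros u v; symmetry; apply is_derive_unique, D2.
Qed.

Lemma smooth2_tensor (a b : R -> R) :
  (forall n, Ck n a) -> (forall n, Ck n b) -> smooth2 (fun u v => a u * b v).
Proof. intros Ha Hb n x y; now apply ex_diff_n_tensor. Qed.

Lemma smooth2_continuous f x y : smooth2 f -> continuity_2d_pt f x y.
Proof. intros H; apply (H 0%nat). Qed.

Lemma smooth2_d1 f : smooth2 f -> smooth2 (fun u v => Derive (fun z => f z v) u).
Proof. intros H n x y; apply (H (S n)). Qed.

Lemma smooth2_d2 f : smooth2 f -> smooth2 (fun u v => Derive (fun z => f u z) v).
Proof. intros H n x y; apply (H (S n)). Qed.

Lemma smooth2_ex1 f u v : smooth2 f -> ex_derive (fun z => f z v) u.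
Proof. intros H; apply (H 1%nat). Qed.

Lemma smooth2_ex2 f u v : smooth2 f -> ex_derive (fun z => f u z) v.
Proof. intros H; apply (H 1%nat u v). Qed.

(** * Trigonometric series in closed form *)

Definition poisson_den (q t : R) : R := 1 - 2 * q * cos t + q ^ 2.

Lemma poisson_den_lower q t : 0 <= q -> (1 - q) ^ 2 <= poisson_den q t.
Proof. intros Hq; unfold poisson_den; generalize (COS_bound t); nra. Qed.

Lemma poisson_den_pos q t : 0 <= q < 1 -> 0 < poisson_den q t.
Proof. intros Hq; generalize (poisson_den_lower q t (proj1 Hq)); nra. Qed.

Lemma pow_geom_bound q n : 0 <= q < 1 -> 0 <= q ^ n <= 1.
Proof.
intros Hq; split; [now apply pow_le|].
rewrite <- (pow1 n); apply pow_incr; lra.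
Qed.

Lemma ex_series_n_geom q : 0 <= q < 1 ->
  ex_series (fun n => INR n * q ^ n) /\
  0 <= Series (fun n => INR n * q ^ n) <= q / (1 - q) ^ 2.
Proof.
intros Hq; apply ex_series_bounded.
- intros n; apply Rmult_le_pos; [apply pos_INR|apply pow_le; lra].
- intros N; apply Rle_div_r; [nra|].
  assert (H : sum_n (fun n => INR n * q ^ n) N * (1 - q) ^ 2
              = q - (INR N + 1) * q ^ (S N) + INR N * q ^ (S (S N))).
  { induction N as [|N IH].
    - rewrite sum_O; simpl; ring.
    - rewrite sum_Sn; unfold plus; simpl (AbelianMonoid.sort _).
      change ((sum_n (fun n => INR n * q ^ n) N + INR (S N) * q ^ S N) * (1 - q) ^ 2
        = q - (INR (S N) + 1) * q ^ S (S N) + INR (S N) * q ^ S (S (S N))).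
      rewrite Rmult_plus_distr_r, IH, S_INR; simpl; ring. }
  rewrite H; simpl.
  assert (H1 := pow_geom_bound q N Hq); assert (H2 := pos_INR N).
  assert (0 <= q * q ^ N) by nra.
  assert (q * (q * q ^ N) <= q * q ^ N) by nra.
  nra.
Qed.

Lemma ex_series_geom_pos q : 0 <= q < 1 -> ex_series (fun n => q ^ n).
Proof. intros Hq; apply ex_series_geom; rewrite Rabs_pos_eq; lra. Qed.

Lemma cos_step t n :
  cos (INR (S (S n)) * t) = 2 * cos t * cos (INR (S n) * t) - cos (INR n * t).
Proof.
replace (INR (S (S n)) * t) with (INR (S n) * t + t) by (rewrite !S_INR; ring).
replace (INR n * t) with (INR (S n) * t - t) by (rewrite !S_INR; ring).
rewrite cos_plus, cos_minus; ring.
Qed.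

Lemma sin_step t n :
  sin (INR (S (S n)) * t) = 2 * cos t * sin (INR (S n) * t) - sin (INR n * t).
Proof.
replace (INR (S (S n)) * t) with (INR (S n) * t + t) by (rewrite !S_INR; ring).
replace (INR n * t) with (INR (S n) * t - t) by (rewrite !S_INR; ring).
rewrite sin_plus, sin_minus; ring.
Qed.

Lemma lim_bounded_mult (a b : nat -> R) :
  is_lim_seq a 0 -> (forall n, Rabs (b n) <= 1) -> is_lim_seq (fun n => a n * b n) 0.
Proof.
intros Ha Hb.
apply is_lim_seq_abs_0, is_lim_seq_le_le with (fun _ => 0) (fun n => Rabs (a n)).
- intros n; split; [apply Rabs_pos|]; rewrite Rabs_mult.
  generalize (Hb n) (Rabs_pos (a n)) (Rabs_pos (b n)); nra.
- apply is_lim_seq_const.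
- now apply (is_lim_seq_abs a 0) in Ha; simpl in Ha; rewrite Rabs_R0 in Ha.
Qed.

Lemma geom_lim q : 0 <= q < 1 -> is_lim_seq (fun n => q ^ n) 0.
Proof. intros Hq; apply ex_series_lim_0, ex_series_geom_pos, Hq. Qed.

Lemma n_geom_lim q : 0 <= q < 1 -> is_lim_seq (fun n => INR n * q ^ n) 0.
Proof. intros Hq; apply ex_series_lim_0, ex_series_n_geom, Hq. Qed.

Lemma cos_le_1 x : Rabs (cos x) <= 1.
Proof. apply Rabs_le, COS_bound. Qed.

Lemma sin_le_1 x : Rabs (sin x) <= 1.
Proof. apply Rabs_le, SIN_bound. Qed.

(** The generating function of a bounded solution of the three-term
    recurrence of [cos (n t)] and [sin (n t)]: multiplication by [poisson_den]
    makes the partial sums telescope. *)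
Lemma is_series_trig q t (a : nat -> R) : 0 <= q < 1 ->
  (forall n, Rabs (a n) <= 1) ->
  (forall n, a (S (S n)) = 2 * cos t * a (S n) - a n) ->
  is_series (fun n => q ^ n * a n)
            ((a 0%nat + q * (a 1%nat - 2 * cos t * a 0%nat)) / poisson_den q t).
Proof.
intros Hq Hb Hrec.
assert (HE := poisson_den_pos q t Hq).
set (A := a 0%nat + q * (a 1%nat - 2 * cos t * a 0%nat)).
assert (Hsum : forall N, sum_n (fun n => q ^ n * a n) N
  = / poisson_den q t * (A - q ^ S N * a (S N) + q ^ 2 * (q ^ N * a N))).
{ intros N; apply Rmult_eq_reg_l with (poisson_den q t); [|lra].
  rewrite <- Rmult_assoc, Rinv_r, Rmult_1_l by lra.
  induction N as [|N IH].
  - rewrite sum_O; unfold A, poisson_den; ring.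
  - rewrite sum_Sn; unfold plus; simpl (AbelianMonoid.sort _).
    match goal with |- _ * ?l = _ =>
      change l with (sum_n (fun n => q ^ n * a n) N + q ^ S N * a (S N)) end.
    rewrite Rmult_plus_distr_l, IH, Hrec; unfold poisson_den; simpl pow; ring. }
assert (HL : is_lim_seq (sum_n (fun n => q ^ n * a n)) (A / poisson_den q t)); [|exact HL].
apply is_lim_seq_ext with (1 := fun N => eq_sym (Hsum N)).
assert (L0 : is_lim_seq (fun N => q ^ N * a N) 0)
  by (apply lim_bounded_mult; [now apply geom_lim|exact Hb]).
assert (L1 := proj1 (is_lim_seq_incr_1 _ _) L0); simpl in L1.
replace (Finite (A / poisson_den q t)) with
  (Rbar_mult (/ poisson_den q t) (Finite (A - 0 + q ^ 2 * 0)))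
  by (simpl; f_equal; field; lra).
apply is_lim_seq_scal_l, is_lim_seq_plus'.
- apply is_lim_seq_minus'; [apply is_lim_seq_const|exact L1].
- apply (is_lim_seq_scal_l _ (q ^ 2) 0), L0.
Qed.

Lemma is_series_cos q t : 0 <= q < 1 ->
  is_series (fun n => q ^ n * cos (INR n * t)) ((1 - q * cos t) / poisson_den q t).
Proof.
intros Hq.
assert (H := is_series_trig q t (fun n => cos (INR n * t)) Hq
  (fun n => cos_le_1 _) (cos_step t)).
cbv beta in H; change (INR 0) with 0 in H; change (INR 1) with 1 in H.
rewrite Rmult_0_l, cos_0, (Rmult_1_l t) in H.
replace (1 - q * cos t) with (1 + q * (cos t - 2 * cos t * 1)) by ring; exact H.
Qed.

Lemma is_series_sin q t : 0 <= q < 1 ->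
  is_series (fun n => q ^ n * sin (INR n * t)) (q * sin t / poisson_den q t).
Proof.
intros Hq.
assert (H := is_series_trig q t (fun n => sin (INR n * t)) Hq
  (fun n => sin_le_1 _) (sin_step t)).
cbv beta in H; change (INR 0) with 0 in H; change (INR 1) with 1 in H.
rewrite Rmult_0_l, sin_0, (Rmult_1_l t) in H.
replace (q * sin t) with (0 + q * (sin t - 2 * cos t * 0)) by ring; exact H.
Qed.

(** Up to the factor [-2], the [t]-derivative of the Poisson kernel in closed
    form.  The same multiplication by [poisson_den] reduces the series to
    [(1 - q^2)] times the sine series, the boundary terms being [O(N q^N)]. *)
Lemma is_series_n_sin q t : 0 <= q < 1 ->
  is_series (fun n => INR n * q ^ n * sin (INR n * t))
            (q * (1 - q ^ 2) * sin t / poisson_den q t ^ 2).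
Proof.
intros Hq.
assert (HE := poisson_den_pos q t Hq).
set (s := fun n => q ^ n * sin (INR n * t)).
set (b := fun n => INR n * q ^ n * sin (INR n * t)).
assert (Hsum : forall N, sum_n b N
  = / poisson_den q t * ((1 - q ^ 2) * sum_n s N + s (S N) + q ^ 2 * s N - b (S N) + q ^ 2 * b N)).
{ intros N; apply Rmult_eq_reg_l with (poisson_den q t); [|lra].
  rewrite <- Rmult_assoc, Rinv_r, Rmult_1_l by lra.
  induction N as [|N IH].
  - rewrite !sum_O; unfold s, b; change (INR 0) with 0; change (INR 1) with 1; rewrite (Rmult_0_l t), sin_0, (Rmult_1_l t); ring.
  - rewrite !sum_Sn; unfold plus; simpl (AbelianMonoid.sort _).
    change (poisson_den q t * (sum_n b N + b (S N))
       = (1 - q ^ 2) * (sum_n s N + s (S N)) + s (S (S N)) + q ^ 2 * s (S N)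
          - b (S (S N)) + q ^ 2 * b (S N)).
    rewrite !Rmult_plus_distr_l, IH.
    unfold b, s; rewrite sin_step; rewrite !S_INR; unfold poisson_den; simpl pow; ring. }
assert (HL : is_lim_seq (sum_n b) (q * (1 - q ^ 2) * sin t / poisson_den q t ^ 2)); [|exact HL].
apply is_lim_seq_ext with (1 := fun N => eq_sym (Hsum N)).
assert (Ls : is_lim_seq s 0)
  by (apply lim_bounded_mult; [now apply geom_lim|intros; apply sin_le_1]).
assert (Lb : is_lim_seq b 0)
  by (apply lim_bounded_mult; [now apply n_geom_lim|intros; apply sin_le_1]).
assert (Ls1 := proj1 (is_lim_seq_incr_1 _ _) Ls); simpl in Ls1.
assert (Lb1 := proj1 (is_lim_seq_incr_1 _ _) Lb); simpl in Lb1.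
assert (HS : is_lim_seq (sum_n s) (q * sin t / poisson_den q t)) by exact (is_series_sin q t Hq).
replace (Finite (q * (1 - q ^ 2) * sin t / poisson_den q t ^ 2)) with
  (Rbar_mult (/ poisson_den q t) (Finite ((1 - q ^ 2) * (q * sin t / poisson_den q t) + 0 + q ^ 2 * 0 - 0 + q ^ 2 * 0)))
  by (simpl; f_equal; field; lra).
apply is_lim_seq_scal_l, is_lim_seq_plus'; [apply is_lim_seq_minus'; [apply is_lim_seq_plus';
  [apply is_lim_seq_plus'|]|]|].
- apply (is_lim_seq_scal_l _ (1 - q ^ 2) (q * sin t / poisson_den q t)), HS.
- exact Ls1.
- apply (is_lim_seq_scal_l _ (q ^ 2) 0), Ls.
- exact Lb1.
- apply (is_lim_seq_scal_l _ (q ^ 2) 0), Lb.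
Qed.

(** * Abel means, Fourier uniqueness and inversion *)

Definition poisson (q t : R) : R := (1 - q ^ 2) / poisson_den q t.

Lemma poisson_pos q t : 0 <= q < 1 -> 0 < poisson q t.
Proof.
intros Hq; apply Rdiv_lt_0_compat; [nra|now apply poisson_den_pos].
Qed.

Lemma continuous_cos_lin c z0 z : continuous (fun z => cos (c * (z - z0))) z.
Proof.
apply (@ex_derive_continuous R_AbsRing R_NormedModule); auto_derive; easy.
Qed.

Definition cos_coef (L : R) (h : R -> R) (z0 : R) (n : nat) : R :=
  RInt (fun z => h z * cos (INR n * (2 * PI / L * (z - z0)))) (- (L / 2)) (L / 2).

Lemma continuous_cos_coef_integrand (h : R -> R) c z0 z n :
  continuous h z -> continuous (fun z => h z * cos (INR n * (c * (z - z0)))) z.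
Proof.
intros Hh; apply (@continuous_mult R_UniformSpace R_AbsRing); [exact Hh|].
apply (@ex_derive_continuous R_AbsRing R_NormedModule); auto_derive; easy.
Qed.

Lemma ex_bound (h : R -> R) (a b : R) :
  a <= b -> (forall z, a <= z <= b -> continuous h z) ->
  exists M, 0 <= M /\ forall z, a <= z <= b -> Rabs (h z) <= M.
Proof.
intros Hab Hc.
destruct (continuity_ab_maj (fun z => Rabs (h z)) a b Hab) as [m [Hm _]].
{ intros z Hz; apply continuity_pt_filterlim.
  apply (continuous_comp h Rabs); [now apply Hc|apply continuous_Rabs]. }
exists (Rabs (h m)); split; [apply Rabs_pos|exact Hm].
Qed.

Lemma is_RInt_poisson (L : R) (h : R -> R) (z0 q : R) :
  0 < L -> 0 <= q < 1 ->
  (forall z, - (L / 2) <= z <= L / 2 -> continuous h z) ->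
  is_RInt (fun z => h z * poisson q (2 * PI / L * (z - z0))) (- (L / 2)) (L / 2)
    (2 * Series (fun n => q ^ n * cos_coef L h z0 n) - cos_coef L h z0 0).
Proof.
intros HL Hq Hc.
destruct (ex_bound h (- (L / 2)) (L / 2) ltac:(lra) Hc) as [M [HM0 HM]].
set (c := 2 * PI / L).
assert (HI := is_RInt_Series (fun n z => q ^ n * (h z * cos (INR n * (c * (z - z0)))))
  (fun n => M * q ^ n) (- (L / 2)) (L / 2)).
apply is_RInt_ext with (fun z =>
  minus (scal 2 (Series (fun n => q ^ n * (h z * cos (INR n * (c * (z - z0)))))))
        (h z * cos (INR 0 * (c * (z - z0))))).
{ intros z _.
  assert (E := is_series_unique _ _ (is_series_cos q (c * (z - z0)) Hq)).
  rewrite Series_ext with (b := fun n => h z * (q ^ n * cos (INR n * (c * (z - z0)))))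
    by (intros; ring).
  rewrite Series_scal_l, E.
  change (INR 0) with 0; rewrite Rmult_0_l, cos_0.
  assert (HE := poisson_den_pos q (c * (z - z0)) Hq).
  unfold minus, plus, opp, scal; simpl; unfold mult; simpl.
  unfold poisson; revert HE; unfold poisson_den; intros HE; field; simpl in *; lra. }
apply (@is_RInt_minus R_NormedModule).
- apply (@is_RInt_scal R_NormedModule).
  rewrite Series_ext with (b := fun n =>
    RInt (fun z => q ^ n * (h z * cos (INR n * (c * (z - z0))))) (- (L / 2)) (L / 2)).
  + apply HI; [lra| | |].
    * intros n z Hz; apply (@continuous_scal_r R_UniformSpace R_AbsRing R_NormedModule (q ^ n)).
      now apply continuous_cos_coef_integrand, Hc.
    * intros n z Hz; rewrite !Rabs_mult.
      assert (H1 := pow_geom_bound q n Hq); rewrite (Rabs_pos_eq (q ^ n)) by lra.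
      specialize (HM z Hz); assert (H2 := cos_le_1 (INR n * (c * (z - z0)))).
      assert (Rabs (h z) * Rabs (cos (INR n * (c * (z - z0)))) <= M * 1).
      { apply Rmult_le_compat; auto using Rabs_pos. }
      nra.
    * apply (@ex_series_scal R_AbsRing R_NormedModule M), ex_series_geom_pos, Hq.
  + intros n; unfold cos_coef; fold c; symmetry.
    apply (RInt_scal (fun z => h z * cos (INR n * (c * (z - z0)))) _ _ (q ^ n)).
    apply (@ex_RInt_continuous R_CompleteNormedModule).
    intros z; rewrite Rmin_left, Rmax_right by lra; intros Hz.
    now apply continuous_cos_coef_integrand, Hc.
- apply (@RInt_correct R_CompleteNormedModule), (@ex_RInt_continuous R_CompleteNormedModule).
  intros z; rewrite Rmin_left, Rmax_right by lra; intros Hz.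
  now apply continuous_cos_coef_integrand, Hc.
Qed.

Lemma cos_coef_one_0 L z0 : 0 < L -> cos_coef L (fun _ => 1) z0 0 = L.
Proof.
intros HL; unfold cos_coef.
rewrite RInt_ext with (g := fun _ => 1).
- rewrite RInt_const; unfold scal; simpl; unfold mult; simpl; lra.
- intros z _; change (INR 0) with 0; rewrite Rmult_0_l, cos_0; exact (Rmult_1_l 1).
Qed.

Lemma is_RInt_cos_lin (c z0 a b : R) : c <> 0 ->
  is_RInt (fun z => cos (c * (z - z0))) a b ((sin (c * (b - z0)) - sin (c * (a - z0))) / c).
Proof.
intros Hc.
replace ((sin (c * (b - z0)) - sin (c * (a - z0))) / c)
  with (minus ((fun z => sin (c * (z - z0)) / c) b) ((fun z => sin (c * (z - z0)) / c) a)).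
- apply (@is_RInt_derive R_CompleteNormedModule (fun z => sin (c * (z - z0)) / c)).
  + intros z _; auto_derive; [easy|].
    change (z + - z0) with (z - z0); field; exact Hc.
  + intros z _; apply continuous_cos_lin.
- unfold minus, plus, opp; simpl; field; exact Hc.
Qed.

Lemma cos_coef_one_S L z0 n : 0 < L -> cos_coef L (fun _ => 1) z0 (S n) = 0.
Proof.
intros HL; unfold cos_coef.
set (c := INR (S n) * (2 * PI / L)).
assert (Hn : 0 < INR (S n)) by (apply lt_0_INR; lia).
assert (Hc : c <> 0).
{ apply Rmult_integral_contrapositive; split; [lra|].
  generalize PI_RGT_0; intros; apply Rgt_not_eq, Rdiv_lt_0_compat; lra. }
rewrite RInt_ext with (g := fun z => cos (c * (z - z0))).
- rewrite (is_RInt_unique _ _ _ _ (is_RInt_cos_lin c z0 _ _ Hc)).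
  replace (c * (L / 2 - z0)) with (c * (- (L / 2) - z0) + 2 * INR (S n) * PI)
    by (unfold c; field; lra).
  rewrite sin_period; field; exact Hc.
- intros z _; unfold c; rewrite Rmult_1_l; f_equal; ring.
Qed.

Lemma is_RInt_poisson_one L z0 q : 0 < L -> 0 <= q < 1 ->
  is_RInt (fun z => poisson q (2 * PI / L * (z - z0))) (- (L / 2)) (L / 2) L.
Proof.
intros HL Hq.
assert (H := is_RInt_poisson L (fun _ => 1) z0 q HL Hq
  (fun z _ => continuous_const 1 z)).
rewrite cos_coef_one_0 in H by exact HL.
rewrite Series_incr_1 in H.
2:{ apply ex_series_incr_1, (ex_series_quad 0).
    intros n; rewrite cos_coef_one_S by exact HL.
    rewrite Rmult_0_r, Rabs_R0; unfold Rdiv; lra. }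
rewrite Series_ext with (b := fun n => 0 * 0) in H
  by (intros n; rewrite cos_coef_one_S by exact HL; ring).
rewrite Series_scal_l, Rmult_0_l, cos_coef_one_0 in H by exact HL.
replace (2 * (q ^ 0 * L + 0) - L) with L in H by (simpl; ring).
apply is_RInt_ext with (2 := H); intros; apply Rmult_1_l.
Qed.

Lemma cos_away a x : 0 <= a <= PI -> a <= x <= 2 * PI - a -> cos x <= cos a.
Proof.
intros Ha Hx.
assert (H := form2 x a).
assert (0 <= sin ((x - a) / 2)) by (apply sin_ge_0; lra).
assert (0 <= sin ((x + a) / 2)) by (apply sin_ge_0; lra).
nra.
Qed.

(** A continuous function is bounded by a small constant plus a multiple of
    the weight [1 - cos], which vanishes only at the base point. *)
Lemma weight_bound (L : R) (h : R -> R) (z0 eps : R) :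
  0 < L -> Rabs z0 < L / 2 -> 0 < eps ->
  (forall z, - (L / 2) <= z <= L / 2 -> continuous h z) ->
  exists C, 0 <= C /\ forall z, - (L / 2) <= z <= L / 2 ->
    Rabs (h z - h z0) <= eps + C * (1 - cos (2 * PI / L * (z - z0))).
Proof.
intros HL Hz0 Heps Hc.
apply Rabs_def2 in Hz0 as Hz0'.
destruct (ex_bound h (- (L / 2)) (L / 2) ltac:(lra) Hc) as [M [HM0 HM]].
assert (Hz0c := proj2 (continuity_pt_filterlim _ _) (Hc z0 ltac:(lra))).
destruct (Hz0c eps Heps) as [d0 [Hd0 Hd]].
set (d := Rmin d0 (Rmin (L / 4) (L / 2 - Rabs z0))).
assert (Hd1 : d <= d0) by apply Rmin_l.
assert (Hd2 : d <= L / 4) by (eapply Rle_trans; [apply Rmin_r|apply Rmin_l]).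
assert (Hd3 : d <= L / 2 - Rabs z0) by (eapply Rle_trans; [apply Rmin_r|apply Rmin_r]).
assert (Hdp : 0 < d) by (repeat apply Rmin_pos; lra).
assert (HPI := PI_RGT_0).
set (k := 2 * PI / L).
assert (Hk : 0 < k) by (apply Rdiv_lt_0_compat; lra).
assert (HkL : k * L = 2 * PI) by (unfold k; field; lra).
assert (Hkd : 0 < k * d <= PI / 2) by nra.
assert (Hw : 0 < 1 - cos (k * d)).
{ assert (cos (k * d) < cos 0) by (apply cos_decreasing_1; lra).
  rewrite cos_0 in *; lra. }
exists (2 * M / (1 - cos (k * d))); split.
{ apply Rle_div_r; lra. }
intros z Hz.
assert (Hcz := COS_bound (k * (z - z0))).
destruct (Rlt_dec (Rabs (z - z0)) d) as [Hlt|Hge].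
- assert (Rabs (h z - h z0) <= eps).
  { destruct (Req_dec z z0) as [->|Hne]; [rewrite Rminus_diag, Rabs_R0; lra|].
    left; apply (Hd z); split; [split; [exact I|lra]|].
    unfold dist; simpl; unfold R_dist; lra. }
  assert (0 <= 2 * M / (1 - cos (k * d))) by (apply Rle_div_r; lra).
  nra.
- assert (Hcc : cos (k * (z - z0)) <= cos (k * d)).
  { replace (cos (k * (z - z0))) with (cos (k * Rabs (z - z0))).
    - assert (Rabs (z - z0) <= L - d).
      { apply Rle_trans with (Rabs z + Rabs z0).
        - unfold Rminus; rewrite <- (Rabs_Ropp z0); apply Rabs_triang.
        - assert (Rabs z <= L / 2) by (apply Rabs_le; lra); lra. }
      apply cos_away; nra.
    - unfold Rabs; destruct Rcase_abs; [|reflexivity].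
      rewrite <- cos_neg; f_equal; ring. }
  assert (Rabs (h z - h z0) <= 2 * M).
  { eapply Rle_trans; [apply Rabs_triang|]; rewrite Rabs_Ropp.
    generalize (HM z Hz) (HM z0 ltac:(lra)); lra. }
  assert (2 * M <= 2 * M / (1 - cos (k * d)) * (1 - cos (k * (z - z0)))).
  { replace (2 * M) with (2 * M / (1 - cos (k * d)) * (1 - cos (k * d))) at 1 by (field; lra).
    apply Rmult_le_compat_l; [apply Rle_div_r; lra|lra]. }
  lra.
Qed.

(** The numerator [1 - q^2] vanishes as [q] tends to [1], while the
    denominator is at least [2 q (1 - cos t)]. *)
Lemma weight_poisson q t : 1 / 2 <= q < 1 -> (1 - cos t) * poisson q t <= 2 * (1 - q).
Proof.
intros Hq; unfold poisson.
assert (HE := poisson_den_pos q t ltac:(lra)).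
assert (Hc := COS_bound t).
replace ((1 - cos t) * ((1 - q ^ 2) / poisson_den q t))
  with ((1 - cos t) * (1 - q ^ 2) / poisson_den q t) by (field; lra).
apply Rle_div_l; [lra|].
unfold poisson_den in *.
assert (0 <= (1 - cos t) * (1 - q) * (3 * q - 1)).
{ apply Rmult_le_pos; [apply Rmult_le_pos|]; lra. }
assert (0 <= (1 - q) ^ 3) by (apply pow_le; lra).
nra.
Qed.

(** The Poisson kernel is an approximate identity: it has total mass [L], and
    by [weight_bound] and [weight_poisson] the deviation of [h] from [h z0] is
    integrated to at most [eps L] plus a multiple of [1 - q]. *)
Lemma abel_means (L : R) (h : R -> R) (z0 eps : R) :
  0 < L -> Rabs z0 < L / 2 -> 0 < eps ->
  (forall z, - (L / 2) <= z <= L / 2 -> continuous h z) ->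
  exists C, forall q, 1 / 2 <= q < 1 ->
    Rabs (2 * Series (fun n => q ^ n * cos_coef L h z0 n) - cos_coef L h z0 0 - L * h z0)
      <= eps * L + C * (1 - q).
Proof.
intros HL Hz0 Heps Hc.
destruct (weight_bound L h z0 eps HL Hz0 Heps Hc) as [C [HC Hw]].
exists (2 * C * L); intros q Hq.
assert (Hq' : 0 <= q < 1) by lra.
set (k := 2 * PI / L) in *.
assert (I1 := is_RInt_poisson L h z0 q HL Hq' Hc); fold k in I1.
assert (I2 := is_RInt_poisson_one L z0 q HL Hq'); fold k in I2.
assert (I3 := @is_RInt_scal R_NormedModule _ _ _ (h z0) _ I2).
assert (I4 := @is_RInt_minus R_NormedModule _ _ _ _ _ _ I1 I3).
assert (I5 : is_RInt (fun z => plus (scal eps (poisson q (k * (z - z0)))) (2 * C * (1 - q)))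
   (- (L / 2)) (L / 2) (plus (scal eps L) (scal (L / 2 - - (L / 2)) (2 * C * (1 - q))))).
{ apply (@is_RInt_plus R_NormedModule); [apply (@is_RInt_scal R_NormedModule), I2|].
  apply (@is_RInt_const R_NormedModule). }
assert (Habs : forall z, - (L / 2) <= z <= L / 2 ->
  norm (minus (h z * poisson q (k * (z - z0))) (scal (h z0) (poisson q (k * (z - z0)))))
   <= plus (scal eps (poisson q (k * (z - z0)))) (2 * C * (1 - q))).
{ intros z Hz.
  unfold norm, minus, plus, opp, scal; simpl; unfold mult, abs; simpl.
  assert (Hp := poisson_pos q (k * (z - z0)) Hq').
  assert (Hwp := weight_poisson q (k * (z - z0)) Hq).
  specialize (Hw z Hz).
  replace (h z * poisson q (k * (z - z0)) + - (h z0 * poisson q (k * (z - z0))))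
    with ((h z - h z0) * poisson q (k * (z - z0))) by ring.
  rewrite Rabs_mult, (Rabs_pos_eq (poisson _ _)) by lra.
  apply Rle_trans with ((eps + C * (1 - cos (k * (z - z0)))) * poisson q (k * (z - z0))).
  - apply Rmult_le_compat_r; lra.
  - nra. }
assert (HLL : - (L / 2) <= L / 2) by lra.
assert (HF := @norm_RInt_le R_NormedModule _ _ _ _ _ _ HLL Habs I4 I5).
unfold norm, minus, plus, opp, scal in HF; simpl in HF; unfold mult, abs in HF; simpl in HF.
match type of HF with Rabs ?x <= ?y =>
  replace (2 * Series (fun n => q ^ n * cos_coef L h z0 n) - cos_coef L h z0 0 - L * h z0)
    with x by ring;
  replace (eps * L + 2 * C * L * (1 - q)) with y by field end.
exact HF.
Qed.

(** Let [q] tend to [1], then [eps] to [0]. *)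
Lemma le_of_le_eps (x L : R) : 0 < L ->
  (forall eps, 0 < eps -> exists C, forall q, 1 / 2 <= q < 1 -> x <= eps * L + C * (1 - q)) ->
  x <= 0.
Proof.
intros HL H.
destruct (Rle_dec x 0) as [|Hx]; [easy|exfalso].
destruct (H (x / (4 * L))) as [C HC]; [apply Rdiv_lt_0_compat; lra|].
set (e := x / (4 * L)) in *.
assert (He : e * L = x / 4) by (unfold e; field; lra).
set (D := Rabs C + 1 + x).
assert (HD : C <= Rabs C) by apply Rle_abs.
assert (HD0 := Rabs_pos C).
assert (Ht : 0 < x / (2 * D) <= 1 / 2).
{ split; [apply Rdiv_lt_0_compat; unfold D; lra|].
  apply Rle_div_l; unfold D; lra. }
specialize (HC (1 - x / (2 * D)) ltac:(lra)).
rewrite He in HC.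
replace (1 - (1 - x / (2 * D))) with (x / (2 * D)) in HC by ring.
assert (C * (x / (2 * D)) <= x / 2); [|lra].
assert (HDp : C <= D /\ 0 < D) by (unfold D; lra).
replace (x / 2) with (D * (x / (2 * D))) by (field; lra).
apply Rmult_le_compat_r; lra.
Qed.

(** All Abel means of the Fourier series of [h] vanish at [z0]. *)
Lemma fourier_unique (L : R) (h : R -> R) (z0 : R) :
  0 < L -> Rabs z0 < L / 2 ->
  (forall z, - (L / 2) <= z <= L / 2 -> continuous h z) ->
  (forall n, cos_coef L h z0 n = 0) -> h z0 = 0.
Proof.
intros HL Hz0 Hc H0.
assert (H : L * Rabs (h z0) <= 0).
{ apply le_of_le_eps with L; [exact HL|].
  intros eps Heps.
  destruct (abel_means L h z0 eps HL Hz0 Heps Hc) as [C HC].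
  exists C; intros q Hq; specialize (HC q Hq).
  rewrite Series_ext with (b := fun n => 0 * 0) in HC by (intros n; rewrite H0; ring).
  rewrite Series_scal_l, H0 in HC.
  replace (2 * (0 * Series (fun _ => 0)) - 0 - L * h z0) with (- (L * h z0)) in HC by ring.
  now rewrite Rabs_Ropp, Rabs_mult, (Rabs_pos_eq L) in HC by lra. }
destruct (Req_dec (h z0) 0) as [|Hne]; [easy|].
generalize (Rabs_pos_lt _ Hne); nra.
Qed.

Lemma one_sub_pow q n : 0 <= q <= 1 -> 0 <= 1 - q ^ n <= INR n * (1 - q).
Proof.
intros Hq; induction n as [|n IH]; [simpl; lra|].
rewrite S_INR; simpl.
assert (0 <= q ^ n) by (apply pow_le; lra).
nra.
Qed.

(** The decay of the coefficients makes the Abel means converge to the sum of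
    the series, because [1 - q^n <= n (1 - q)]. *)
Lemma fourier_inversion (L : R) (h : R -> R) (B : R) :
  0 < L ->
  (forall z, - (L / 2) <= z <= L / 2 -> continuous h z) ->
  (forall n, (INR n + 1) * Rabs (cos_coef L h 0 n) <= B / (INR n + 1) ^ 2) ->
  2 * Series (cos_coef L h 0) - cos_coef L h 0 0 = L * h 0.
Proof.
intros HL Hc HB.
set (c := cos_coef L h 0) in *.
assert (Hdom : forall n, Rabs (INR n * c n) <= B * / (INR n + 1) ^ 2).
{ intros n; rewrite Rabs_mult, (Rabs_pos_eq (INR n)) by apply pos_INR.
  eapply Rle_trans; [|apply HB].
  generalize (Rabs_pos (c n)); nra. }
assert (HexB : ex_series (fun n => B * / (INR n + 1) ^ 2)).
{ apply (@ex_series_scal R_AbsRing R_NormedModule B (fun n => / (INR n + 1) ^ 2)), ex_series_inv_sq. }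
set (T := Series (fun n => B * / (INR n + 1) ^ 2)).
assert (Hc0 : forall n, Rabs (c n) <= B * / (INR n + 1) ^ 2).
{ intros n; eapply Rle_trans; [|apply HB].
  generalize (Rabs_pos (c n)) (pos_INR n); nra. }
assert (Hexc := proj1 (ex_series_dominated _ _ Hc0 HexB)).
assert (H : Rabs (2 * Series c - c 0%nat - L * h 0) <= 0).
{ apply le_of_le_eps with L; [exact HL|].
  intros eps Heps.
  destruct (abel_means L h 0 eps HL ltac:(rewrite Rabs_R0; lra) Heps Hc) as [C HC].
  exists (C + 2 * T); intros q Hq; specialize (HC q Hq); fold c in HC.
  assert (Hd1 : forall n, Rabs ((1 - q ^ n) * c n) <= (1 - q) * (B * / (INR n + 1) ^ 2)).
  { intros n; assert (H1 := one_sub_pow q n ltac:(lra)).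
    eapply Rle_trans; [|apply Rmult_le_compat_l, Hdom; lra].
    rewrite !Rabs_mult, (Rabs_pos_eq (1 - q ^ n)), (Rabs_pos_eq (INR n)) by (try apply pos_INR; lra).
    generalize (Rabs_pos (c n)); nra. }
  destruct (ex_series_dominated _ _ Hd1) as [Hex1 HT].
  { now apply (@ex_series_scal R_AbsRing R_NormedModule (1 - q)). }
  rewrite Series_scal_l in HT; fold T in HT.
  assert (E : Series (fun n => q ^ n * c n) = Series c - Series (fun n => (1 - q ^ n) * c n)).
  { rewrite <- Series_minus by assumption; apply Series_ext; intros; ring. }
  rewrite E in HC.
  apply Rabs_le_between in HC; apply Rabs_le_between in HT; apply Rabs_le; lra. }
assert (H1 := Rabs_pos (2 * Series c - c 0%nat - L * h 0)).
apply Rminus_diag_uniq, Rabs_eq_0; lra.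
Qed.

(** * The kernel near the wall point *)

Lemma exp_half_le_2 a : 0 <= a <= 1 / 2 -> exp a <= 2.
Proof.
intros Ha.
assert (H := exp_le_3).
assert (E : exp 1 = exp (1 / 2) * exp (1 / 2)) by (rewrite <- exp_plus; f_equal; field).
assert (exp a <= exp (1 / 2)) by (destruct (Req_dec a (1 / 2)) as [->|]; [lra|left; apply exp_increasing; lra]).
generalize (exp_pos (1 / 2)); nra.
Qed.

Lemma is_derive_sinh x : is_derive sinh x (cosh x).
Proof. apply is_derive_Reals, derivable_pt_lim_sinh. Qed.

Lemma is_derive_cosh x : is_derive cosh x (sinh x).
Proof. apply is_derive_Reals, derivable_pt_lim_cosh. Qed.

Lemma cosh_ge_1 x : 1 <= cosh x.
Proof.
unfold cosh.
assert (E : exp x * exp (- x) = 1) by (rewrite <- exp_plus, Rplus_opp_r; apply exp_0).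
assert (Hu := exp_pos x); assert (Hv := exp_pos (- x)).
set (u := exp x) in *; set (v := exp (- x)) in *.
assert (H := pow2_ge_0 (u - v)).
destruct (Rle_dec 2 (u + v)); nra.
Qed.

Lemma sinh_ge x : 0 <= x -> x <= sinh x.
Proof.
intros Hx.
assert (H : sinh 0 - 0 <= sinh x - x).
{ apply (le_of_derive (fun x => sinh x - x) (fun x => cosh x - 1)); [exact Hx| |].
  - intros t _; apply (@is_derive_minus R_AbsRing R_NormedModule);
      [apply is_derive_sinh|apply (@is_derive_id R_AbsRing)].
  - intros t _; generalize (cosh_ge_1 t); lra. }
rewrite sinh_0 in H; lra.
Qed.

Lemma sinh_le_2x x : 0 <= x <= 1 / 2 -> sinh x <= 2 * x.
Proof.
intros Hx.
assert (H : 2 * 0 - sinh 0 <= 2 * x - sinh x).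
{ apply (le_of_derive (fun x => 2 * x - sinh x) (fun x => 2 - cosh x)); [lra| |].
  - intros t _; apply (@is_derive_minus R_AbsRing R_NormedModule);
      [auto_derive; [easy|ring]|apply is_derive_sinh].
  - intros t Ht; unfold cosh.
    assert (H1 := exp_half_le_2 t ltac:(lra)).
    assert (exp (- t) <= exp 0)
      by (destruct (Req_dec t 0) as [->|]; [rewrite Ropp_0; lra|left; apply exp_increasing; lra]).
    rewrite exp_0 in *; lra. }
rewrite sinh_0 in H; lra.
Qed.

Lemma cosh_le x : 0 <= x <= 1 / 2 -> cosh x <= 1 + x ^ 2.
Proof.
intros Hx.
assert (H : 0 ^ 2 - cosh 0 <= x ^ 2 - cosh x).
{ apply (le_of_derive (fun x => x ^ 2 - cosh x) (fun x => 2 * x - sinh x)); [lra| |].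
  - intros t _; apply (@is_derive_minus R_AbsRing R_NormedModule);
      [auto_derive; [easy|ring]|apply is_derive_cosh].
  - intros t Ht; generalize (sinh_le_2x t ltac:(lra)); lra. }
rewrite cosh_0 in H; lra.
Qed.

Lemma sinh_le x : 0 <= x <= 1 / 2 -> sinh x <= x + x ^ 3.
Proof.
intros Hx.
assert (H : 0 + 0 ^ 3 - sinh 0 <= x + x ^ 3 - sinh x).
{ apply (le_of_derive (fun x => x + x ^ 3 - sinh x) (fun x => 1 + 3 * x ^ 2 - cosh x)); [lra| |].
  - intros t _; apply (@is_derive_minus R_AbsRing R_NormedModule);
      [auto_derive; [easy|ring]|apply is_derive_sinh].
  - intros t Ht; generalize (cosh_le t ltac:(lra)); nra. }
rewrite sinh_0 in H; lra.
Qed.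

Lemma sin_le_x x : 0 <= x -> sin x <= x.
Proof.
intros Hx.
assert (H : 0 - sin 0 <= x - sin x).
{ apply (le_of_derive (fun x => x - sin x) (fun x => 1 - cos x)); [lra| |].
  - intros t _; auto_derive; [easy|ring].
  - intros t _; generalize (COS_bound t); lra. }
rewrite sin_0 in H; lra.
Qed.

Lemma cos_ge x : 0 <= x -> 1 - x ^ 2 <= cos x.
Proof.
intros Hx.
assert (H : cos 0 + 0 ^ 2 <= cos x + x ^ 2).
{ apply (le_of_derive (fun x => cos x + x ^ 2) (fun x => 2 * x - sin x)); [lra| |].
  - intros t _; auto_derive; [easy|ring].
  - intros t Ht; generalize (sin_le_x t ltac:(lra)); lra. }
rewrite cos_0 in H; lra.
Qed.

Lemma sin_ge x : 0 <= x -> x - x ^ 3 <= sin x.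
Proof.
intros Hx.
assert (H : sin 0 + 0 ^ 3 - 0 <= sin x + x ^ 3 - x).
{ apply (le_of_derive (fun x => sin x + x ^ 3 - x) (fun x => cos x + 3 * x ^ 2 - 1)); [lra| |].
  - intros t _; auto_derive; [easy|ring].
  - intros t Ht; generalize (cos_ge t ltac:(lra)); nra. }
rewrite sin_0 in H; lra.
Qed.

(** Each of the four factors of the numerator agrees with its leading term up
    to a relative error of order [R = a^2 + b^2], and so does the square root of
    the denominator; hence the quotient does too. *)
Lemma half_angle_quotient_pos a b : 0 < a <= 1 / 2 -> 0 <= b <= 1 / 2 ->
  Rabs (sinh a * cosh a * (sin b * cos b) / (sinh a ^ 2 + sin b ^ 2) ^ 2
        - a * b / (a ^ 2 + b ^ 2) ^ 2) <= 200 * (a * b / (a ^ 2 + b ^ 2)).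
Proof.
intros Ha Hb.
set (R := a ^ 2 + b ^ 2).
assert (HR : 0 < R <= 1 / 2) by (unfold R; nra).
assert (Hab : a ^ 2 <= R /\ b ^ 2 <= R) by (unfold R; nra).
assert (S1 := sinh_ge a ltac:(lra)); assert (S2 := sinh_le a ltac:(lra)).
assert (C1 := cosh_ge_1 a); assert (C2 := cosh_le a ltac:(lra)).
assert (T1 := sin_le_x b ltac:(lra)); assert (T2 := sin_ge b ltac:(lra)).
assert (D1 := proj2 (COS_bound b)); assert (D2 := cos_ge b ltac:(lra)).
set (sh := sinh a) in *; set (ch := cosh a) in *; set (s := sin b) in *; set (c := cos b) in *.
assert (Hsh : a <= sh <= a * (1 + R)) by nra.
assert (Hch : 1 <= ch <= 1 + R) by nra.
assert (Hs : b * (1 - R) <= s <= b) by nra.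
assert (Hc : 1 - R <= c <= 1) by nra.
clear S1 S2 C1 C2 T1 T2 D1 D2.
set (N := sh * ch * (s * c)).
assert (HN1 : 0 <= sh * ch <= a * (1 + R) * (1 + R)).
{ split; [apply Rmult_le_pos; lra|].
  apply Rmult_le_compat; lra. }
assert (HN2 : b * (1 - R) * (1 - R) <= s * c <= b * 1).
{ split; [apply Rmult_le_compat; try lra; apply Rmult_le_pos; lra|].
  apply Rmult_le_compat; try lra.
  apply Rle_trans with (b * (1 - R)); [apply Rmult_le_pos; lra|lra]. }
assert (HN1' : a <= sh * ch).
{ replace a with (a * 1) by ring; apply Rmult_le_compat; lra. }
assert (HN2' : 0 <= b * (1 - R) * (1 - R)) by (repeat apply Rmult_le_pos; lra).
assert (Hab0 : 0 <= a * b) by nra.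
assert (HN : a * b * (1 - R) ^ 2 <= N <= a * b * (1 + R) ^ 2).
{ unfold N; split.
  - apply Rle_trans with (a * (b * (1 - R) * (1 - R))); [right; ring|].
    apply Rmult_le_compat; lra.
  - apply Rle_trans with (a * (1 + R) * (1 + R) * (b * 1)); [|right; ring].
    apply Rmult_le_compat; lra. }
set (D := sh ^ 2 + s ^ 2).
assert (HD : R * (1 - R) ^ 2 <= D <= R * (1 + R) ^ 2).
{ assert (H1 : a ^ 2 <= sh ^ 2 <= (a * (1 + R)) ^ 2) by (split; apply pow_incr; lra).
  assert (H2 : (b * (1 - R)) ^ 2 <= s ^ 2 <= b ^ 2).
  { split; apply pow_incr; split; try lra; [apply Rmult_le_pos; lra|].
    apply Rle_trans with (b * (1 - R)); [apply Rmult_le_pos; lra|lra]. }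
  rewrite Rpow_mult_distr in H1, H2.
  unfold D; split.
  - replace (R * (1 - R) ^ 2) with (a ^ 2 * (1 - R) ^ 2 + b ^ 2 * (1 - R) ^ 2) by (unfold R; ring).
    assert (a ^ 2 * (1 - R) ^ 2 <= a ^ 2) by nra. lra.
  - replace (R * (1 + R) ^ 2) with (a ^ 2 * (1 + R) ^ 2 + b ^ 2 * (1 + R) ^ 2) by (unfold R; ring).
    assert (b ^ 2 <= b ^ 2 * (1 + R) ^ 2) by nra. lra. }
assert (HDp : 0 < D).
{ apply Rlt_le_trans with (R * (1 - R) ^ 2); [apply Rmult_lt_0_compat; nra|lra]. }
assert (HD2 : R ^ 2 * (1 - R) ^ 4 <= D ^ 2 <= R ^ 2 * (1 + R) ^ 4).
{ replace (R ^ 2 * (1 - R) ^ 4) with ((R * (1 - R) ^ 2) ^ 2) by ring.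
  replace (R ^ 2 * (1 + R) ^ 4) with ((R * (1 + R) ^ 2) ^ 2) by ring.
  split; apply pow_incr; split; try lra; apply Rmult_le_pos; nra. }
assert (HD2p : 0 < D ^ 2) by nra.
assert (HR2 : 0 < R ^ 2) by nra.
assert (Hlow : 1 / 16 <= (1 - R) ^ 4).
{ replace (1 / 16) with ((1 / 2) ^ 4) by field; apply pow_incr; lra. }
replace (N / D ^ 2 - a * b / R ^ 2) with ((N * R ^ 2 - a * b * D ^ 2) / (D ^ 2 * R ^ 2)) by (field; lra).
unfold Rdiv at 1; rewrite Rabs_mult, Rabs_inv, (Rabs_pos_eq (D ^ 2 * R ^ 2)) by nra.
apply Rle_div_l; [nra|].
apply Rle_trans with (12 * (a * b) * R ^ 3).
- assert (U : N * R ^ 2 <= a * b * (1 + R) ^ 2 * R ^ 2) by (apply Rmult_le_compat_r; lra).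
  assert (U' : a * b * (1 - R) ^ 2 * R ^ 2 <= N * R ^ 2) by (apply Rmult_le_compat_r; lra).
  assert (V : a * b * D ^ 2 <= a * b * (R ^ 2 * (1 + R) ^ 4)) by (apply Rmult_le_compat_l; lra).
  assert (V' : a * b * (R ^ 2 * (1 - R) ^ 4) <= a * b * D ^ 2) by (apply Rmult_le_compat_l; lra).
  assert (W1 : (1 + R) ^ 2 - (1 - R) ^ 4 <= 12 * R) by nra.
  assert (W2 : (1 + R) ^ 4 - (1 - R) ^ 2 <= 12 * R).
  { assert (R ^ 2 <= R / 2) by nra. assert (R ^ 3 <= R / 4) by nra. assert (R ^ 4 <= R / 8) by nra. nra. }
  assert (P : 0 <= a * b * R ^ 2) by (apply Rmult_le_pos; lra).
  apply Rabs_le; split.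
  + assert (a * b * R ^ 2 * ((1 + R) ^ 4 - (1 - R) ^ 2) <= a * b * R ^ 2 * (12 * R))
      by (apply Rmult_le_compat_l; lra).
    nra.
  + assert (a * b * R ^ 2 * ((1 + R) ^ 2 - (1 - R) ^ 4) <= a * b * R ^ 2 * (12 * R))
      by (apply Rmult_le_compat_l; lra).
    nra.
- replace (200 * (a * b / R) * (D ^ 2 * R ^ 2)) with (a * b * R * (200 * D ^ 2)) by (field; lra).
  replace (12 * (a * b) * R ^ 3) with (a * b * R * (12 * R ^ 2)) by ring.
  apply Rmult_le_compat_l; [apply Rmult_le_pos; lra|].
  assert (R ^ 2 * (1 / 16) <= R ^ 2 * (1 - R) ^ 4) by (apply Rmult_le_compat_l; lra).
  lra.
Qed.

Lemma half_angle_quotient a b : 0 < a <= 1 / 2 -> Rabs b <= 1 / 2 ->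
  Rabs (sinh a * cosh a * (sin b * cos b) / (sinh a ^ 2 + sin b ^ 2) ^ 2
        - a * b / (a ^ 2 + b ^ 2) ^ 2) <= 100.
Proof.
intros Ha Hb.
assert (Hpos : forall b, 0 <= b <= 1 / 2 ->
  Rabs (sinh a * cosh a * (sin b * cos b) / (sinh a ^ 2 + sin b ^ 2) ^ 2
        - a * b / (a ^ 2 + b ^ 2) ^ 2) <= 100).
{ clear b Hb; intros b Hb.
  eapply Rle_trans; [apply half_angle_quotient_pos; assumption|].
  assert (a * b / (a ^ 2 + b ^ 2) <= 1 / 2); [|lra].
  generalize (pow2_ge_0 (a - b)); intros Hsq; apply Rle_div_l; simpl in *; nra. }
destruct (Rle_dec 0 b) as [H|H].
- apply Hpos; rewrite Rabs_pos_eq in Hb; lra.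
- rewrite Rabs_left in Hb by lra.
  specialize (Hpos (- b) ltac:(lra)).
  rewrite sin_neg, cos_neg in Hpos.
  rewrite <- Rabs_Ropp in Hpos.
  eapply Rle_trans; [right|exact Hpos]; f_equal.
  replace ((- sin b) ^ 2) with (sin b ^ 2) by ring.
  replace ((- b) ^ 2) with (b ^ 2) by ring.
  unfold Rdiv; ring.
Qed.

Lemma poisson_den_half_angle a b :
  poisson_den (exp (- (2 * a))) (2 * b) = 4 * exp (- (2 * a)) * (sinh a ^ 2 + sin b ^ 2).
Proof.
unfold poisson_den, sinh.
rewrite cos_2a_sin.
assert (E : exp (- (2 * a)) = exp (- a) * exp (- a)) by (rewrite <- exp_plus; f_equal; ring).
assert (E1 : exp a * exp (- a) = 1) by (rewrite <- exp_plus, Rplus_opp_r; apply exp_0).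
rewrite E.
set (u := exp a) in *; set (v := exp (- a)) in *.
replace (4 * (v * v) * (((u - v) / 2) ^ 2 + sin b ^ 2))
  with ((u * v) * (u * v) - 2 * (u * v) * (v * v) + v * v * (v * v) + 4 * (v * v) * sin b ^ 2) by field.
rewrite E1; ring.
Qed.

(** With [q = e^{-X}] and half angles, the closed form becomes one half of the
    quotient of [half_angle_quotient] at [(X/2, t/2)], whose leading term is
    [2 X t / (X^2 + t^2)^2]. *)
Lemma poisson_derivative_expansion X t : 0 < X <= 1 -> Rabs t <= 1 ->
  Rabs (Series (fun n => INR n * exp (- X) ^ n * sin (INR n * t))
        - 2 * (X * t / (X ^ 2 + t ^ 2) ^ 2)) <= 50.
Proof.
intros HX Ht.
assert (Hq : 0 <= exp (- X) < 1).
{ split; [left; apply exp_pos|]; rewrite <- exp_0; apply exp_increasing; lra. }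
rewrite (is_series_unique _ _ (is_series_n_sin (exp (- X)) t Hq)).
set (a := X / 2); set (b := t / 2).
assert (H := half_angle_quotient a b ltac:(unfold a; lra)
  ltac:(unfold b, Rdiv; rewrite Rabs_mult, Rabs_inv, (Rabs_pos_eq 2); lra)).
replace X with (2 * a) by (unfold a; field).
replace t with (2 * b) by (unfold b; field).
rewrite poisson_den_half_angle, sin_2a.
assert (Ha : 0 < a) by (unfold a; lra).
assert (Hs : 0 < sinh a) by (generalize (sinh_ge a ltac:(lra)); lra).
assert (HE := exp_pos (- (2 * a))).
assert (HE2 : 1 - exp (- (2 * a)) ^ 2 = 4 * exp (- (2 * a)) * (sinh a * cosh a)).
{ unfold sinh, cosh.
  assert (E : exp (- (2 * a)) = exp (- a) * exp (- a)) by (rewrite <- exp_plus; f_equal; ring).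
  assert (E1 : exp a * exp (- a) = 1) by (rewrite <- exp_plus, Rplus_opp_r; apply exp_0).
  rewrite E; set (u := exp a) in *; set (v := exp (- a)) in *.
  replace (4 * (v * v) * ((u - v) / 2 * ((u + v) / 2))) with ((u * v) * (u * v) - (v * v) ^ 2) by field.
  rewrite E1; ring. }
rewrite HE2.
match goal with |- Rabs ?x <= _ =>
  replace x with (/ 2 * (sinh a * cosh a * (sin b * cos b) / (sinh a ^ 2 + sin b ^ 2) ^ 2
    - a * b / (a ^ 2 + b ^ 2) ^ 2)) end.
- rewrite Rabs_mult, (Rabs_pos_eq (/ 2)) by lra; lra.
- field; repeat split; nra.
Qed.

Definition freq (L : R) (n : nat) : R := INR n * (2 * PI / L).

Lemma freq_nonneg L n : 0 < L -> 0 <= freq L n.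
Proof.
intros HL; apply Rmult_le_pos; [apply pos_INR|].
generalize PI_RGT_0; intros; left; apply Rdiv_lt_0_compat; lra.
Qed.

(** Minus the [z]-derivative of the Poisson kernel of the cylinder with pole at
    [(1,0)], as a sine series. *)
Definition recoveryK (L r z : R) : R :=
  2 / L * Series (fun n => freq L n * profile (freq L n) r * sin (freq L n * z)).

(** Replacing each mode by [e^{-k x}] changes the sum by at most a multiple of
    [x * sum k_n e^{-k_n x} = O(1/x)]; what remains is the periodic half-plane
    kernel.  The constant is [2/pi] because the leading term
    [(2/L) k 2 X t / (X^2+t^2)^2], with [X = k x], [t = k y], is homogeneous of
    degree [-2] and [L k = 2 pi]. *)
Lemma recoveryK_expansion (L : R) : 0 < L -> exists C, 0 <= C /\
  forall x y, 0 < x <= 1 / 2 -> 2 * PI / L * x <= 1 -> Rabs (2 * PI / L * y) <= 1 ->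
    Rabs (recoveryK L (1 - x) y - 2 / PI * (x * y / (x ^ 2 + y ^ 2) ^ 2)) <= C / x.
Proof.
intros HL.
set (k := 2 * PI / L).
assert (HPI := PI_RGT_0).
assert (Hk : 0 < k) by (apply Rdiv_lt_0_compat; lra).
exists (2 / L * (k * (8 / k ^ 2 + 50))); split.
{ assert (0 < 8 / k ^ 2) by (apply Rdiv_lt_0_compat; nra).
  apply Rmult_le_pos; [left; apply Rdiv_lt_0_compat; lra|nra]. }
intros x y Hx HX HY.
set (X := k * x) in *; set (t := k * y) in *.
assert (HX0 : 0 < X) by (unfold X; nra).
set (q := exp (- X)).
assert (Hq : 0 <= q < 1).
{ split; [left; apply exp_pos|]; unfold q; rewrite <- exp_0; apply exp_increasing; lra. }
assert (Hqn : forall n, exp (- (freq L n * (1 - (1 - x)))) = q ^ n).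
{ intros n; unfold q; induction n as [|n IH].
  - unfold freq; simpl; rewrite <- exp_0; f_equal; ring.
  - simpl pow; rewrite <- IH, <- exp_plus; f_equal; unfold freq; rewrite S_INR; fold k; unfold X; ring. }
assert (Hdiff : forall n, Rabs (freq L n * profile (freq L n) (1 - x) * sin (freq L n * y)
    - k * (INR n * q ^ n * sin (INR n * t))) <= 8 * x * k * (INR n * q ^ n)).
{ intros n.
  assert (Hf := freq_nonneg L n HL).
  destruct (profile_exp_bounds (freq L n) (1 - x) Hf ltac:(lra)) as [P1 P2].
  rewrite Hqn in P1, P2.
  replace (freq L n * y) with (INR n * t) by (unfold freq, t; fold k; ring).
  replace (freq L n * profile (freq L n) (1 - x) * sin (INR n * t) - k * (INR n * q ^ n * sin (INR n * t)))
    with (k * INR n * (profile (freq L n) (1 - x) - q ^ n) * sin (INR n * t))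
    by (unfold freq; fold k; ring).
  assert (Hqp : 0 <= q ^ n) by (apply pow_le; lra).
  assert (Hn := pos_INR n).
  assert (P3 : 0 <= profile (freq L n) (1 - x) - q ^ n <= 8 * x * q ^ n).
  { split; [lra|].
    assert (q ^ n / (1 - x) ^ 2 <= q ^ n * (1 + 8 * x)); [|lra].
    unfold Rdiv; apply Rmult_le_compat_l; [exact Hqp|].
    rewrite <- (Rmult_1_l (/ _)); apply Rle_div_l; nra. }
  rewrite !Rabs_mult.
  rewrite (Rabs_pos_eq k), (Rabs_pos_eq (INR n)), (Rabs_pos_eq (profile _ _ - _)) by lra.
  replace (8 * x * k * (INR n * q ^ n)) with (k * INR n * (8 * x * q ^ n) * 1) by ring.
  assert (0 <= k * INR n) by nra.
  apply Rmult_le_compat; [|apply Rabs_pos| |apply sin_le_1].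
  - apply Rmult_le_pos; lra.
  - apply Rmult_le_compat_l; lra. }
destruct (ex_series_n_geom q Hq) as [Hex Hbd].
destruct (ex_series_dominated _ _ Hdiff) as [Hexd Hd].
{ now apply (@ex_series_scal R_AbsRing R_NormedModule (8 * x * k)). }
rewrite Series_scal_l in Hd.
assert (Hex2 : ex_series (fun n => k * (INR n * q ^ n * sin (INR n * t)))).
{ apply (@ex_series_scal R_AbsRing R_NormedModule k); eexists; apply is_series_n_sin, Hq. }
assert (E : Series (fun n => freq L n * profile (freq L n) (1 - x) * sin (freq L n * y))
  = Series (fun n => freq L n * profile (freq L n) (1 - x) * sin (freq L n * y)
    - k * (INR n * q ^ n * sin (INR n * t)))
    + k * Series (fun n => INR n * q ^ n * sin (INR n * t))).
{ rewrite <- Series_scal_l, <- Series_plus by assumption; apply Series_ext; intros; ring. }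
unfold recoveryK; rewrite E.
set (S1 := Series (fun n => freq L n * profile (freq L n) (1 - x) * sin (freq L n * y)
    - k * (INR n * q ^ n * sin (INR n * t)))) in *.
assert (HP := poisson_derivative_expansion X t ltac:(lra) HY); fold q in HP.
set (S2 := Series (fun n => INR n * q ^ n * sin (INR n * t))) in *.
assert (Hxy : 0 < x ^ 2 + y ^ 2) by nra.
replace (2 / PI * (x * y / (x ^ 2 + y ^ 2) ^ 2))
  with (2 / L * (k * (2 * (X * t / (X ^ 2 + t ^ 2) ^ 2)))).
2:{ replace (X ^ 2 + t ^ 2) with (k ^ 2 * (x ^ 2 + y ^ 2)) by (unfold X, t; ring).
    generalize (x ^ 2 + y ^ 2), Hxy; intros rho Hrho; unfold X, t, k; field; lra. }
replace (2 / L * (S1 + k * S2) - 2 / L * (k * (2 * (X * t / (X ^ 2 + t ^ 2) ^ 2))))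
  with (2 / L * (S1 + k * (S2 - 2 * (X * t / (X ^ 2 + t ^ 2) ^ 2)))) by ring.
assert (HL2 : 0 < 2 / L) by (apply Rdiv_lt_0_compat; lra).
rewrite Rabs_mult, (Rabs_pos_eq (2 / L)) by lra.
replace (2 / L * (k * (8 / k ^ 2 + 50)) / x)
  with (2 / L * (k * (8 / k ^ 2 + 50) * / x)) by (field; lra).
apply Rmult_le_compat_l; [lra|].
eapply Rle_trans; [apply Rabs_triang|].
rewrite Rabs_mult, (Rabs_pos_eq k) by lra.
assert (Hqx : q / (1 - q) ^ 2 <= 1 / X ^ 2).
{ assert (Hs := sinh_ge (X / 2) ltac:(lra)); unfold sinh in Hs.
  assert (Eq : q = exp (- (X / 2)) * exp (- (X / 2))) by (unfold q; rewrite <- exp_plus; f_equal; field).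
  assert (E1 : exp (X / 2) * exp (- (X / 2)) = 1) by (rewrite <- exp_plus, Rplus_opp_r; apply exp_0).
  set (u := exp (X / 2)) in *; set (v := exp (- (X / 2))) in *.
  assert (Hv : 0 < v) by apply exp_pos.
  assert (H : X * v <= 1 - q).
  { rewrite Eq, <- E1; nra. }
  apply Rle_div_l; [nra|].
  replace (1 / X ^ 2 * (1 - q) ^ 2) with ((1 - q) ^ 2 / X ^ 2) by (field; lra).
  apply Rle_div_r; [nra|].
  replace (q * X ^ 2) with ((X * v) ^ 2) by (rewrite Eq; ring).
  apply pow_incr; split; [nra|exact H]. }
assert (H1 : Rabs S1 <= k * (8 / k ^ 2) * / x).
{ eapply Rle_trans; [exact Hd|].
  apply Rle_trans with (8 * x * k * (1 / X ^ 2)).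
  - apply Rmult_le_compat_l; [nra|lra].
  - right; unfold X; field; lra. }
assert (H2 : k * Rabs (S2 - 2 * (X * t / (X ^ 2 + t ^ 2) ^ 2)) <= k * 50 * / x).
{ rewrite <- (Rmult_1_r (k * Rabs _)).
  apply Rmult_le_compat; [apply Rmult_le_pos; [lra|apply Rabs_pos]|lra|nra|].
  rewrite <- Rinv_1; apply Rinv_le_contravar; lra. }
rewrite Rmult_plus_distr_l, Rmult_plus_distr_r; lra.
Qed.

(** * Regularity of the kernel and decay of Fourier coefficients *)

Lemma continuity_2d_Series (u : nat -> R -> R -> R) (M : nat -> R) (x y : R) :
  locally_2d (fun a b => forall n, Rabs (u n a b) <= M n) x y ->
  (forall n, continuity_2d_pt (u n) x y) -> ex_series M ->
  continuity_2d_pt (fun a b => Series (fun n => u n a b)) x y.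
Proof.
intros Hb Hc HM eps.
assert (He : 0 < eps / 3) by (generalize (cond_pos eps); lra).
assert (Hxy := locally_2d_singleton _ _ _ Hb).
assert (HN : exists N, Series M - sum_n M N < eps / 3).
{ destruct HM as [l Hl].
  assert (Hl' : is_series M l) by exact Hl.
  destruct (proj1 (filterlim_locally _ _) Hl (mkposreal _ He)) as [N HN].
  exists N; specialize (HN N (le_n N)).
  rewrite (is_series_unique _ _ Hl').
  unfold ball in HN; simpl in HN; unfold AbsRing_ball, abs, minus, plus, opp in HN; simpl in HN.
  apply Rabs_def2 in HN; destruct HN as [_ HN].
  assert (HN2 : - (eps / 3) < sum_n M N - l) by exact HN; lra. }
destruct HN as [N HN].
assert (Hfin : continuity_2d_pt (fun a b => sum_n (fun n => u n a b) N) x y).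
{ clear - Hc; induction N as [|N IH].
  - apply continuity_2d_pt_ext with (u 0%nat); [intros; now rewrite sum_O|apply Hc].
  - apply continuity_2d_pt_ext with (fun a b => sum_n (fun n => u n a b) N + u (S N) a b).
    + intros; now rewrite sum_Sn.
    + now apply continuity_2d_pt_plus. }
generalize (locally_2d_and _ _ _ _ Hb (Hfin (mkposreal _ He))).
apply locally_2d_impl, locally_2d_forall; intros a b [Hab Hs]; simpl in Hs.
assert (T1 := series_tail M (fun n => u n a b) N Hab HM).
assert (T2 := series_tail M (fun n => u n x y) N Hxy HM).
apply Rabs_le_between in T1; apply Rabs_le_between in T2; apply Rabs_def2 in Hs.
apply Rabs_def1; lra.
Qed.

Lemma freq_decay L n r : 0 < L ->
  exp (- (freq L n * (1 - r))) = exp (- (2 * PI / L * (1 - r))) ^ n.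
Proof.
intros HL; induction n as [|n IH].
- unfold freq; simpl; rewrite <- exp_0; f_equal; ring.
- simpl pow; rewrite <- IH, <- exp_plus; f_equal; unfold freq; rewrite S_INR; ring.
Qed.

Lemma two_PI_div_pos L : 0 < L -> 0 < 2 * PI / L.
Proof. intros HL; generalize PI_RGT_0; intros; apply Rdiv_lt_0_compat; lra. Qed.

Lemma ex_series_freq_profile L r : 0 < L -> 0 < r < 1 ->
  ex_series (fun n => freq L n * profile (freq L n) r).
Proof.
intros HL Hr.
assert (Hk := two_PI_div_pos L HL).
set (q := exp (- (2 * PI / L * (1 - r)))).
assert (Hq : 0 <= q < 1).
{ assert (0 < 2 * PI / L * (1 - r)) by (apply Rmult_lt_0_compat; lra).
  split; [left; apply exp_pos|].
  apply Rlt_le_trans with (exp 0); [apply exp_increasing; lra|rewrite exp_0; lra]. }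
apply (ex_series_dominated (fun n => 2 * PI / L / r ^ 2 * (INR n * q ^ n))).
- intros n.
  assert (Hf := freq_nonneg L n HL).
  assert (Hb := profile_bounds (freq L n) r Hf ltac:(lra)).
  destruct (profile_exp_bounds (freq L n) r Hf ltac:(lra)) as [_ H].
  rewrite freq_decay in H by exact HL; fold q in H.
  rewrite Rabs_pos_eq by (apply Rmult_le_pos; lra).
  replace (2 * PI / L / r ^ 2 * (INR n * q ^ n)) with (freq L n * (q ^ n / r ^ 2))
    by (unfold freq; field; lra).
  apply Rmult_le_compat_l; lra.
- apply (@ex_series_scal R_AbsRing R_NormedModule), ex_series_n_geom, Hq.
Qed.

Lemma profile_incr k r s : 0 <= k -> 0 <= r <= s -> profile k r <= profile k s.
Proof.
intros Hk Hrs; unfold profile, Rdiv; apply Rmult_le_compat_r.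
- left; apply Rinv_0_lt_compat; generalize (besselU_ge_1 k); lra.
- apply besselU_incr; split; [apply Rmult_le_pos|apply Rmult_le_compat_l]; lra.
Qed.

Lemma continuous_profile k r : continuous (profile k) r.
Proof.
apply (@ex_derive_continuous R_AbsRing R_NormedModule); eexists; apply is_derive_profile.
Qed.

Lemma continuous_sin_lin k z : continuous (fun z => sin (k * z)) z.
Proof.
apply (@ex_derive_continuous R_AbsRing R_NormedModule); auto_derive; easy.
Qed.

Lemma recoveryK_continuity L r z : 0 < L -> 0 < r < 1 ->
  continuity_2d_pt (recoveryK L) r z.
Proof.
intros HL Hr; unfold recoveryK.
apply continuity_2d_pt_mult; [apply continuity_2d_pt_const|].
set (r1 := (1 + r) / 2).
apply continuity_2d_Series with (fun n => freq L n * profile (freq L n) r1).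
- assert (Hd : 0 < Rmin r ((1 - r) / 2)) by (apply Rmin_pos; lra).
  exists (mkposreal _ Hd); intros a b Ha _ n; simpl in Ha.
  assert (A1 := Rlt_le_trans _ _ _ Ha (Rmin_l _ _)).
  assert (A2 := Rlt_le_trans _ _ _ Ha (Rmin_r _ _)).
  apply Rabs_def2 in A1; apply Rabs_def2 in A2.
  assert (Hf := freq_nonneg L n HL).
  assert (Hp := profile_incr (freq L n) a r1 Hf ltac:(unfold r1; lra)).
  assert (Hp0 := profile_bounds (freq L n) a Hf ltac:(lra)).
  rewrite !Rabs_mult, (Rabs_pos_eq (freq L n)), (Rabs_pos_eq (profile _ _)) by lra.
  rewrite <- (Rmult_1_r (freq L n * profile _ r1)).
  apply Rmult_le_compat; [apply Rmult_le_pos; lra|apply Rabs_pos| |apply sin_le_1].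
  apply Rmult_le_compat_l; lra.
- intros n; apply (continuity_2d_tensor (fun r => freq L n * profile (freq L n) r)
                     (fun z => sin (freq L n * z))).
  + apply (@continuous_scal_r R_UniformSpace R_AbsRing R_NormedModule), continuous_profile.
  + apply continuous_sin_lin.
- apply ex_series_freq_profile; [exact HL|unfold r1; lra].
Qed.

Lemma recoveryK_periodic L r z : 0 < L -> recoveryK L r (z + L) = recoveryK L r z.
Proof.
intros HL; unfold recoveryK; f_equal; apply Series_ext; intros n; f_equal.
replace (freq L n * (z + L)) with (freq L n * z + 2 * INR n * PI) by (unfold freq; field; lra).
apply sin_period.
Qed.

Definition dr (f : R -> R -> R) (u v : R) : R := Derive (fun z => f z v) u.
Definition dz (f : R -> R -> R) (u v : R) : R := Derive (fun z => f u z) v.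
Definition periodic2 (L : R) (f : R -> R -> R) : Prop :=
  forall r z, f r (z + L) = f r z.

Lemma periodic2_dr L f : periodic2 L f -> periodic2 L (dr f).
Proof. intros H r z; unfold dr; apply Derive_ext; intros t; apply H. Qed.

Lemma periodic2_dz L f : smooth2 f -> periodic2 L f -> periodic2 L (dz f).
Proof.
intros Hs H r z; unfold dz.
rewrite <- (Derive_ext (fun t => f r (t + L)) (fun t => f r t) z) by (intros; apply H).
symmetry; apply is_derive_unique; evar_last.
- apply (is_derive_comp (fun t => f r t) (fun t => t + L)).
  + apply Derive_correct, smooth2_ex2, Hs.
  + auto_derive; [easy|reflexivity].
- unfold scal; simpl; unfold mult; simpl; ring.
Qed.

Lemma periodic2_ends L f r : periodic2 L f -> f r (L / 2) = f r (- (L / 2)).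
Proof. intros H; rewrite <- (H r (- (L / 2))); f_equal; field. Qed.

Definition sin_coef (L : R) (f : R -> R -> R) (n : nat) (r : R) : R :=
  RInt (fun z => sin (freq L n * z) * f r z) (- (L / 2)) (L / 2).

Lemma continuity_2d_sin_mult k f x y :
  continuity_2d_pt f x y -> continuity_2d_pt (fun u v => sin (k * v) * f u v) x y.
Proof.
intros Hf; apply continuity_2d_pt_mult; [|exact Hf].
apply (continuity_1d_2d_pt_comp (fun v => sin (k * v)) (fun _ v => v)); [|apply continuity_2d_pt_id2].
apply continuity_pt_filterlim, continuous_sin_lin.
Qed.

Lemma ex_RInt_sin_coef k f r a b : smooth2 f -> ex_RInt (fun z => sin (k * z) * f r z) a b.
Proof.
intros Hf; apply (ex_RInt_of_2d (fun r z => sin (k * z) * f r z)).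
intros t; apply continuity_2d_sin_mult, smooth2_continuous, Hf.
Qed.

Lemma is_derive_sin_coef L f n r : smooth2 f ->
  is_derive (sin_coef L f n) r (sin_coef L (dr f) n r).
Proof.
intros Hf; unfold sin_coef.
set (k := freq L n).
assert (HD : forall u t, Derive (fun z => sin (k * t) * f z t) u = sin (k * t) * dr f u t).
{ intros u t; apply Derive_scal. }
rewrite <- (RInt_ext (fun t => Derive (fun u => sin (k * t) * f u t) r)) by (intros; apply HD).
apply (is_derive_RInt_param (fun r z => sin (k * z) * f r z)).
- apply filter_forall; intros u t _.
  apply ex_derive_scal, smooth2_ex1, Hf.
- intros t _.
  apply continuity_2d_pt_ext with (fun u v => sin (k * v) * dr f u v);
    [intros; symmetry; apply HD|].
  apply continuity_2d_sin_mult, smooth2_continuous, smooth2_d1, Hf.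
- apply filter_forall; intros u; now apply ex_RInt_sin_coef.
Qed.

Lemma is_derive_dz f r z : smooth2 f -> is_derive (fun z => f r z) z (dz f r z).
Proof. intros Hf; apply Derive_correct, smooth2_ex2, Hf. Qed.

Lemma is_derive_sin_lin k z : is_derive (fun z => sin (k * z)) z (k * cos (k * z)).
Proof. auto_derive; [easy|ring]. Qed.

Lemma is_derive_cos_lin k z : is_derive (fun z => cos (k * z)) z (- k * sin (k * z)).
Proof. auto_derive; [easy|ring]. Qed.

Lemma sin_cos_ends L n : 0 < L ->
  sin (freq L n * (L / 2)) = 0 /\ sin (freq L n * - (L / 2)) = 0 /\
  cos (freq L n * (L / 2)) = cos (freq L n * - (L / 2)).
Proof.
intros HL.
replace (freq L n * - (L / 2)) with (- (freq L n * (L / 2))) by ring.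
rewrite sin_neg, cos_neg.
assert (H : sin (freq L n * (L / 2)) = 0).
{ replace (freq L n * (L / 2)) with (INR n * PI) by (unfold freq; field; lra).
  apply sin_eq_0_1; exists (Z.of_nat n); now rewrite INR_IZR_INZ. }
rewrite H; repeat split; lra.
Qed.

(** Two integrations by parts over a period; the boundary terms cancel by
    periodicity. *)
Lemma sin_coef_dzdz L f n r : 0 < L -> smooth2 f -> periodic2 L f ->
  sin_coef L (dz (dz f)) n r = - (freq L n ^ 2 * sin_coef L f n r).
Proof.
intros HL Hf Hp.
set (k := freq L n).
assert (Hf2 : smooth2 (dz f)) by now apply smooth2_d2.
assert (Hf22 : smooth2 (dz (dz f))) by now apply smooth2_d2.
destruct (sin_cos_ends L n HL) as [S1 [S2 C]]; fold k in S1, S2, C.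
assert (H := @is_RInt_derive R_CompleteNormedModule
  (fun z => sin (k * z) * dz f r z - k * (cos (k * z) * f r z))
  (fun z => k ^ 2 * (sin (k * z) * f r z) + sin (k * z) * dz (dz f) r z) (- (L / 2)) (L / 2)).
assert (E : is_RInt (fun z => k ^ 2 * (sin (k * z) * f r z) + sin (k * z) * dz (dz f) r z)
   (- (L / 2)) (L / 2) 0).
{ evar_last; [apply H|].
  - intros z _; evar_last.
    + apply (@is_derive_minus R_AbsRing R_NormedModule).
      * apply (is_derive_mult (fun z => sin (k * z)) (fun z => dz f r z));
          [apply is_derive_sin_lin|now apply is_derive_dz|apply Rmult_comm].
      * apply is_derive_scal.
        apply (is_derive_mult (fun z => cos (k * z)) (fun z => f r z));
          [apply is_derive_cos_lin|now apply is_derive_dz|apply Rmult_comm].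
    + unfold minus, plus, opp, mult; simpl; ring.
  - intros z _.
    apply (@continuous_plus R_UniformSpace R_AbsRing R_NormedModule).
    + apply (@continuous_scal_r R_UniformSpace R_AbsRing R_NormedModule (k ^ 2)).
      apply (continuous_of_2d (fun r z => sin (k * z) * f r z)).
      apply continuity_2d_sin_mult, smooth2_continuous, Hf.
    + apply (continuous_of_2d (fun r z => sin (k * z) * dz (dz f) r z)).
      apply continuity_2d_sin_mult, smooth2_continuous, Hf22.
  - unfold minus, plus, opp; simpl; rewrite S1, S2, C, (periodic2_ends L f r Hp); ring. }
assert (I1 : is_RInt (fun z => k ^ 2 * (sin (k * z) * f r z)) (- (L / 2)) (L / 2) (k ^ 2 * sin_coef L f n r)).
{ apply (@is_RInt_scal R_NormedModule), (@RInt_correct R_CompleteNormedModule).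
  now apply ex_RInt_sin_coef. }
assert (I2 : is_RInt (fun z => sin (k * z) * dz (dz f) r z) (- (L / 2)) (L / 2) (sin_coef L (dz (dz f)) n r)).
{ apply (@RInt_correct R_CompleteNormedModule); now apply ex_RInt_sin_coef. }
assert (I3 := @is_RInt_plus R_NormedModule _ _ _ _ _ _ I1 I2).
assert (U := is_RInt_unique _ _ _ _ I3).
assert (V := is_RInt_unique _ _ _ _ E).
assert (W : k ^ 2 * sin_coef L f n r + sin_coef L (dz (dz f)) n r = 0) by exact (eq_trans (eq_sym U) V).
lra.
Qed.

(** The bound is uniform in [n] because [|sin| <= 1], and uniform in [r]
    because the integral of [|f(r,.)|] is continuous on [[0,1]]. *)
Lemma sin_coef_bounded L f : 0 < L -> smooth2 f ->
  exists C, forall n r, 0 <= r <= 1 -> Rabs (sin_coef L f n r) <= C.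
Proof.
intros HL Hf.
assert (Hcont : forall r t, continuity_2d_pt (fun r z => Rabs (f r z)) r t).
{ intros r t; apply (continuity_1d_2d_pt_comp Rabs f);
    [apply Rcontinuity_abs|now apply smooth2_continuous]. }
destruct (ex_bound (fun r => RInt (fun z => Rabs (f r z)) (- (L / 2)) (L / 2)) 0 1 ltac:(lra)) as [C [_ HC]].
{ intros r _; apply (continuous_RInt_param (fun r z => Rabs (f r z))); [lra|].
  apply filter_forall; intros u t; apply Hcont. }
exists C; intros n r Hr.
eapply Rle_trans; [|apply (HC r Hr)].
eapply Rle_trans; [|apply Rle_abs].
unfold sin_coef.
eapply Rle_trans; [apply abs_RInt_le; [lra|now apply ex_RInt_sin_coef]|].
apply RInt_le; [lra| | |].
- apply (ex_RInt_of_2d (fun r z => Rabs (sin (freq L n * z) * f r z))); intros t.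
  apply (continuity_1d_2d_pt_comp Rabs (fun r z => sin (freq L n * z) * f r z));
    [apply Rcontinuity_abs|].
  apply continuity_2d_sin_mult, smooth2_continuous, Hf.
- apply (ex_RInt_of_2d (fun r z => Rabs (f r z))); intros t; apply Hcont.
- intros z _; rewrite Rabs_mult.
  generalize (sin_le_1 (freq L n * z)) (Rabs_pos (f r z)) (Rabs_pos (sin (freq L n * z))); nra.
Qed.

Lemma sin_coef_decay L m : forall f, 0 < L -> smooth2 f -> periodic2 L f ->
  exists C, forall n r, 0 <= r <= 1 -> freq L n ^ (2 * m) * Rabs (sin_coef L f n r) <= C.
Proof.
induction m as [|m IH]; intros f HL Hf Hp.
- destruct (sin_coef_bounded L f HL Hf) as [C HC].
  exists C; intros n r Hr; simpl; rewrite Rmult_1_l; now apply HC.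
- destruct (IH (dz (dz f)) HL) as [C HC].
  { now apply smooth2_d2, smooth2_d2. }
  { apply periodic2_dz; [now apply smooth2_d2|now apply periodic2_dz]. }
  exists C; intros n r Hr.
  eapply Rle_trans; [|apply (HC n r Hr)].
  rewrite sin_coef_dzdz by assumption.
  rewrite Rabs_Ropp, Rabs_mult, (Rabs_pos_eq (freq L n ^ 2)) by apply pow2_ge_0.
  replace (2 * S m)%nat with (2 * m + 2)%nat by lia.
  rewrite pow_add; right; ring.
Qed.

(** * The kernel represents the functional *)

(** A bound by the inverse square of the frequency says nothing at [n = 0],
    where the frequency is zero; the sequence has to vanish there. *)
Lemma quadratic_decay L C (a : nat -> R) : 0 < L ->
  a 0%nat = 0 -> (forall n, freq L n ^ 2 * Rabs (a n) <= C) ->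
  forall n, Rabs (a n) <= (4 * C / (2 * PI / L) ^ 2) * / (INR n + 1) ^ 2.
Proof.
intros HL H0 H n.
assert (Hk := two_PI_div_pos L HL); unfold freq in H; set (k := 2 * PI / L) in *.
assert (HC : 0 <= C).
{ eapply Rle_trans; [|apply (H 0%nat)]; apply Rmult_le_pos; [apply pow2_ge_0|apply Rabs_pos]. }
assert (Hn1 : 0 < INR n + 1) by (generalize (pos_INR n); lra).
assert (Hn2 : 0 < (INR n + 1) ^ 2) by now apply pow_lt.
assert (Hk2 : 0 < k ^ 2) by now apply pow_lt.
destruct n as [|n].
- rewrite H0, Rabs_R0; apply Rmult_le_pos; [|left; now apply Rinv_0_lt_compat].
  apply -> Rle_div_r; lra.
- apply -> Rle_div_r; [|exact Hn2].
  apply -> Rle_div_r; [|exact Hk2].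
  specialize (H (S n)).
  assert (Hn : 1 <= INR (S n)) by (rewrite S_INR; generalize (pos_INR n); lra).
  set (N := INR (S n)) in *.
  assert (Ha := Rabs_pos (a (S n))).
  apply Rle_trans with (Rabs (a (S n)) * (4 * N ^ 2) * k ^ 2).
  + apply Rmult_le_compat_r; [nra|]; apply Rmult_le_compat_l; nra.
  + replace (Rabs (a (S n)) * (4 * N ^ 2) * k ^ 2) with (4 * ((N * k) ^ 2 * Rabs (a (S n)))) by ring.
    lra.
Qed.

Lemma pow_le_1_plus_pow_S K n : 0 <= K -> K ^ n <= 1 + K ^ S n.
Proof.
intros HK; assert (Hn : 0 <= K ^ n) by now apply pow_le.
destruct (Rle_dec K 1) as [H|H]; [|simpl; nra].
assert (K ^ n <= 1 ^ n) by (apply pow_incr; lra).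
assert (0 <= K ^ S n) by now apply pow_le.
rewrite pow1 in *; lra.
Qed.

(** Testing the kernel against [- Delta5 phi], mode by mode in [z].  Each mode
    of the pairing is an exact derivative (Green's identity), and the sine
    coefficients of the smooth function [phi] decay so fast that every sum
    converges uniformly up to the wall and to the axis. *)
Section Solution.
Variables (L : R) (phi : R -> R -> R).
Hypothesis HL : 0 < L.
Hypothesis Hphi : smooth2 phi.
Hypothesis Hper : periodic2 L phi.
Hypothesis Hwall : forall z, phi 1 z = 0.

Let k := freq L.
Let s n := sin_coef L phi n.
Let s1 n := sin_coef L (dr phi) n.
Let s2 n := sin_coef L (dr (dr phi)) n.

(* [c n] is the n-th mode of the inner integral of the pairing, [T n] the
   primitive of [c n] given by Green's identity. *)
Let c (n : nat) (r : R) : R :=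
  - (2 / L * k n) * profile (k n) r
  * (r ^ 3 * s2 n r + 3 * r ^ 2 * s1 n r - k n ^ 2 * r ^ 3 * s n r).
Let T (n : nat) (r : R) : R :=
  2 / L * k n * (r ^ 3 * profile' (k n) r * s n r - r ^ 3 * (profile (k n) r * s1 n r)).

Let S1phi : smooth2 (dr phi). Proof. now apply smooth2_d1. Qed.
Let S2phi : smooth2 (dr (dr phi)). Proof. now apply smooth2_d1. Qed.
Let P1phi : periodic2 L (dr phi). Proof. now apply periodic2_dr. Qed.
Let P2phi : periodic2 L (dr (dr phi)). Proof. now apply periodic2_dr. Qed.

Lemma is_derive_T n r : is_derive (T n) r (c n r).
Proof.
unfold T, c; evar_last.
- apply is_derive_scal.
  apply (@is_derive_minus R_AbsRing R_NormedModule).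
  + apply (is_derive_mult (fun r => r ^ 3 * profile' (k n) r) (s n));
      [apply is_derive_r3_profile'|now apply is_derive_sin_coef|apply Rmult_comm].
  + apply (is_derive_mult (fun r => r ^ 3) (fun r => profile (k n) r * s1 n r)).
    * auto_derive; [easy|reflexivity].
    * apply (is_derive_mult (profile (k n)) (s1 n));
        [apply is_derive_profile|now apply is_derive_sin_coef|apply Rmult_comm].
    * apply Rmult_comm.
- unfold minus, plus, opp, mult; simpl; fold (s1 n) (s2 n); ring.
Qed.

Lemma continuous_c n r : continuous (c n) r.
Proof.
unfold c.
apply (@continuous_mult R_UniformSpace R_AbsRing).
- apply (@continuous_scal_r R_UniformSpace R_AbsRing R_NormedModule), continuous_profile.
- apply (@ex_derive_continuous R_AbsRing R_NormedModule).
  apply (@ex_derive_minus R_AbsRing R_NormedModule).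
  + apply (@ex_derive_plus R_AbsRing R_NormedModule).
    * apply ex_derive_mult; [auto_derive; easy|eexists; now apply is_derive_sin_coef].
    * apply ex_derive_mult; [auto_derive; easy|eexists; now apply is_derive_sin_coef].
  + apply ex_derive_mult; [auto_derive; easy|eexists; now apply is_derive_sin_coef].
Qed.

Lemma is_RInt_c n : is_RInt (c n) 0 1 (- (2 / L * k n * s1 n 1)).
Proof.
evar_last.
- apply (@is_RInt_derive R_CompleteNormedModule (T n)); intros x _;
    [apply is_derive_T|apply continuous_c].
- unfold minus, plus, opp, T; simpl.
  assert (E : s n 1 = 0).
  { unfold s, sin_coef.
    rewrite RInt_ext with (g := fun _ => 0).
    - rewrite RInt_const; unfold scal; simpl; unfold mult; simpl; ring.
    - intros z _; rewrite Hwall; apply Rmult_0_r. }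
  rewrite E, profile_1; ring.
Qed.

(** Odd powers of the frequency are absorbed by the neighbouring even ones, for
    which the decay is available; one factor [k^2] is kept for summability. *)
Lemma c_bound : exists C, forall n r, 0 <= r <= 1 ->
  Rabs (c n r) <= C * / (INR n + 1) ^ 2.
Proof.
destruct (sin_coef_bounded L phi HL Hphi) as [A0 HA0].
destruct (sin_coef_decay L 3 phi HL Hphi Hper) as [A HA].
destruct (sin_coef_bounded L _ HL S1phi) as [B0 HB0].
destruct (sin_coef_decay L 2 _ HL S1phi P1phi) as [B HB].
destruct (sin_coef_bounded L _ HL S2phi) as [D0 HD0].
destruct (sin_coef_decay L 2 _ HL S2phi P2phi) as [D HD].
exists (4 * (2 / L * ((D0 + D) + 3 * (B0 + B) + (A0 + A))) / (2 * PI / L) ^ 2).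
intros n r Hr; revert n.
apply (quadratic_decay L _ (fun n => c n r) HL).
{ unfold c, k, freq; simpl; ring. }
intros n; fold k.
assert (Hk : 0 <= k n) by now apply freq_nonneg.
specialize (HA0 n r Hr); specialize (HA n r Hr); fold k (s n) in HA0, HA.
specialize (HB0 n r Hr); specialize (HB n r Hr); fold k (s1 n) in HB0, HB.
specialize (HD0 n r Hr); specialize (HD n r Hr); fold k (s2 n) in HD0, HD.
change (2 * 3)%nat with 6%nat in HA; change (2 * 2)%nat with 4%nat in HB, HD.
assert (Hp := profile_bounds (k n) r Hk Hr).
assert (H2L : 0 < 2 / L) by (apply Rdiv_lt_0_compat; lra).
assert (Q1 := Rabs_pos (s n r)); assert (Q2 := Rabs_pos (s1 n r)); assert (Q3 := Rabs_pos (s2 n r)).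
assert (R2 : 0 <= r ^ 2 <= 1) by nra.
assert (R3 : 0 <= r ^ 3 <= 1) by nra.
set (K := k n) in *.
assert (K3 := pow_le_1_plus_pow_S K 3 Hk).
assert (K5 := pow_le_1_plus_pow_S K 5 Hk).
assert (W : Rabs (r ^ 3 * s2 n r + 3 * r ^ 2 * s1 n r - K ^ 2 * r ^ 3 * s n r)
   <= Rabs (s2 n r) + 3 * Rabs (s1 n r) + K ^ 2 * Rabs (s n r)).
{ unfold Rminus; eapply Rle_trans; [apply Rabs_triang|].
  apply Rplus_le_compat; [eapply Rle_trans; [apply Rabs_triang|apply Rplus_le_compat]|].
  - rewrite Rabs_mult, (Rabs_pos_eq (r ^ 3)) by lra; nra.
  - rewrite Rabs_mult, (Rabs_pos_eq (3 * r ^ 2)) by lra; nra.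
  - rewrite Rabs_Ropp, Rabs_mult, (Rabs_pos_eq (K ^ 2 * r ^ 3)) by (apply Rmult_le_pos; [apply pow2_ge_0|lra]).
    apply Rmult_le_compat_r; [lra|]; generalize (pow2_ge_0 K); nra. }
set (Z := r ^ 3 * s2 n r + 3 * r ^ 2 * s1 n r - K ^ 2 * r ^ 3 * s n r) in *.
unfold c; fold K Z.
rewrite !Rabs_mult, Rabs_Ropp, !Rabs_mult, (Rabs_pos_eq (2 / L)), (Rabs_pos_eq K), (Rabs_pos_eq (profile _ _)) by lra.
apply Rle_trans with (2 / L * (K ^ 3 * (Rabs (s2 n r) + 3 * Rabs (s1 n r) + K ^ 2 * Rabs (s n r)))).
- replace (K ^ 2 * (2 / L * K * profile K r * Rabs Z)) with (2 / L * (K ^ 3 * (profile K r * Rabs Z))) by ring.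
  apply Rmult_le_compat_l; [lra|]; apply Rmult_le_compat_l; [apply pow_le; lra|].
  generalize (Rabs_pos Z); nra.
- apply Rmult_le_compat_l; [lra|].
  replace (K ^ 3 * (Rabs (s2 n r) + 3 * Rabs (s1 n r) + K ^ 2 * Rabs (s n r)))
    with (K ^ 3 * Rabs (s2 n r) + 3 * (K ^ 3 * Rabs (s1 n r)) + K ^ 5 * Rabs (s n r)) by ring.
  assert (K ^ 3 * Rabs (s2 n r) <= (1 + K ^ 4) * Rabs (s2 n r)) by (apply Rmult_le_compat_r; lra).
  assert (K ^ 3 * Rabs (s1 n r) <= (1 + K ^ 4) * Rabs (s1 n r)) by (apply Rmult_le_compat_r; lra).
  assert (K ^ 5 * Rabs (s n r) <= (1 + K ^ 6) * Rabs (s n r)) by (apply Rmult_le_compat_r; lra).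
  lra.
Qed.

(** At [r = 1] only the term with [dr phi] of the primitive [T] survives.  One
    integration by parts turns [k_n] times its sine coefficient into a cosine
    coefficient of [dz (dr phi)], whose Fourier series is then evaluated at
    [z = 0]. *)
Lemma wall_series : Series (fun n => - (2 / L * k n * s1 n 1)) = Defs.sigma phi.
Proof.
set (h := fun z => dz (dr phi) 1 z).
assert (Hh : forall z, continuous h z).
{ intros z; apply (continuous_of_2d (dz (dr phi))), smooth2_continuous, smooth2_d2, S1phi. }
assert (Hc : forall n, cos_coef L h 0 n = k n * s1 n 1).
{ intros n; unfold cos_coef.
  destruct (sin_cos_ends L n HL) as [E1 [E2 E3]]; fold k in E1, E2, E3.
  rewrite RInt_ext with (g := fun z => cos (k n * z) * h z).
  2:{ intros z _; unfold k, freq; rewrite Rminus_0_r, <- Rmult_assoc; apply Rmult_comm. }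
  assert (H : is_RInt (fun z => - k n * (sin (k n * z) * dr phi 1 z) + cos (k n * z) * h z)
     (- (L / 2)) (L / 2) 0).
  { evar_last.
    - apply (@is_RInt_derive R_CompleteNormedModule (fun z => cos (k n * z) * dr phi 1 z)).
      + intros z _; evar_last.
        * apply (is_derive_mult (fun z => cos (k n * z)) (fun z => dr phi 1 z));
            [apply is_derive_cos_lin|now apply is_derive_dz|apply Rmult_comm].
        * unfold plus, mult, h; simpl; ring.
      + intros z _.
        apply (@continuous_plus R_UniformSpace R_AbsRing R_NormedModule).
        * apply (@continuous_scal_r R_UniformSpace R_AbsRing R_NormedModule (- k n)).
          apply (continuous_of_2d (fun r z => sin (k n * z) * dr phi r z)).
          apply continuity_2d_sin_mult, smooth2_continuous, S1phi.
        * apply (@continuous_mult R_UniformSpace R_AbsRing); [|apply Hh].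
          apply (@ex_derive_continuous R_AbsRing R_NormedModule); auto_derive; easy.
    - unfold minus, plus, opp; simpl; rewrite E3, (periodic2_ends L (dr phi) 1 P1phi); ring. }
  assert (I1 : is_RInt (fun z => - k n * (sin (k n * z) * dr phi 1 z)) (- (L / 2)) (L / 2) (- k n * s1 n 1)).
  { apply (@is_RInt_scal R_NormedModule), (@RInt_correct R_CompleteNormedModule).
    now apply ex_RInt_sin_coef. }
  assert (I2 := @is_RInt_minus R_NormedModule _ _ _ _ _ _ H I1).
  transitivity (minus 0 (- k n * s1 n 1)); [|unfold minus, plus, opp; simpl; ring].
  apply is_RInt_unique.
  apply is_RInt_ext with (2 := I2); intros z _.
  unfold minus, plus, opp; simpl; ring. }
destruct (sin_coef_decay L 2 _ HL S1phi P1phi) as [B HB].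
assert (Hinv : 2 * Series (cos_coef L h 0) - cos_coef L h 0 0 = L * h 0).
{ apply fourier_inversion with (8 * B / (2 * PI / L) ^ 3); [exact HL|intros; apply Hh|].
  intros n; rewrite Hc.
  specialize (HB n 1 ltac:(lra)); fold (s1 n) in HB; change (2 * 2)%nat with 4%nat in HB.
  assert (Hkp := two_PI_div_pos L HL); unfold k, freq in *; set (q := 2 * PI / L) in *.
  assert (HBp : 0 <= B).
  { eapply Rle_trans; [|exact HB]; apply Rmult_le_pos; [|apply Rabs_pos].
    apply pow_le, Rmult_le_pos; [apply pos_INR|lra]. }
  assert (Hq3 : 0 < q ^ 3) by (apply pow_lt; lra).
  assert (Hn1 : 0 < INR n + 1) by (generalize (pos_INR n); lra).
  destruct n as [|n].
  - simpl INR; rewrite Rmult_0_l, Rmult_0_l, Rabs_R0, Rmult_0_r.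
    apply Rmult_le_pos; [apply Rmult_le_pos; [lra|left; now apply Rinv_0_lt_compat]|].
    left; apply Rinv_0_lt_compat; lra.
  - assert (Hn : 1 <= INR (S n)) by (rewrite S_INR; generalize (pos_INR n); lra).
    set (N := INR (S n)) in *; set (a := s1 (S n) 1) in *.
    apply -> Rle_div_r; [|apply pow_lt; lra]; apply -> Rle_div_r; [|exact Hq3].
    rewrite !Rabs_mult, (Rabs_pos_eq N), (Rabs_pos_eq q) by lra.
    apply Rle_trans with (8 * ((N * q) ^ 4 * Rabs a)); [|lra].
    replace ((N + 1) * (N * q * Rabs a) * (N + 1) ^ 2 * q ^ 3)
      with ((N + 1) ^ 3 * (N * q ^ 4 * Rabs a)) by ring.
    replace (8 * ((N * q) ^ 4 * Rabs a)) with ((2 * N) ^ 3 * (N * q ^ 4 * Rabs a)) by ring.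
    apply Rmult_le_compat_r; [|apply pow_incr; lra].
    apply Rmult_le_pos; [apply Rmult_le_pos; [lra|apply pow_le; lra]|apply Rabs_pos]. }
rewrite sigma_dirichlet by exact Hwall.
change (Derive (fun z => Derive (fun r => phi r z) 1) 0) with (h 0).
replace (cos_coef L h 0 0) with 0 in Hinv.
2:{ rewrite Hc; unfold k, freq; simpl; ring. }
rewrite Series_ext with (b := fun n => - (2 / L) * cos_coef L h 0 n) by (intros n; rewrite Hc; ring).
rewrite Series_scal_l.
replace (h 0) with (2 / L * Series (cos_coef L h 0)).
- replace (fun n => cos_coef L h 0 n) with (cos_coef L h 0) by reflexivity; ring.
- apply Rmult_eq_reg_l with L; [|lra]; rewrite <- Hinv; field; lra.
Qed.

(** For fixed [r < 1] the exponential decay of the profiles allows termwise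
    integration in [z]. *)
Lemma inner_integral (G : R -> R -> R) r :
  (forall r z, 0 < r < 1 -> - Delta5 phi r z = G r z) -> 0 < r < 1 ->
  RInt (fun z => recoveryK L r z * G r z * r ^ 3) (- (L / 2)) (L / 2)
  = Series (fun n => c n r).
Proof.
intros HG Hr.
set (g := fun z => - (dr (dr phi) r z + 3 / r * dr phi r z + dz (dz phi) r z)).
assert (Szz : smooth2 (dz (dz phi))) by now apply smooth2_d2, smooth2_d2.
assert (Hg : forall z, continuous g z).
{ intros z; apply (continuous_of_2d (fun u z => - (dr (dr phi) u z + 3 / r * dr phi u z + dz (dz phi) u z))).
  apply continuity_2d_pt_opp, continuity_2d_pt_plus; [apply continuity_2d_pt_plus|].
  - now apply smooth2_continuous.
  - apply continuity_2d_pt_mult; [apply continuity_2d_pt_const|now apply smooth2_continuous].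
  - now apply smooth2_continuous. }
destruct (ex_bound g (- (L / 2)) (L / 2) ltac:(lra) (fun z _ => Hg z)) as [M [HM0 HM]].
assert (H2L : 0 < 2 / L) by (apply Rdiv_lt_0_compat; lra).
assert (Hr3 : 0 < r ^ 3) by (apply pow_lt; lra).
set (u := fun n z => 2 / L * (k n * profile (k n) r) * r ^ 3 * (sin (k n * z) * g z)).
assert (HI := is_RInt_Series u (fun n => 2 / L * r ^ 3 * M * (k n * profile (k n) r)) (- (L / 2)) (L / 2)
  ltac:(lra)).
transitivity (Series (fun n => RInt (u n) (- (L / 2)) (L / 2))).
- apply is_RInt_unique.
  apply is_RInt_ext with (fun z => Series (fun n => u n z)).
  + intros z _; rewrite <- HG by exact Hr.
    change (- Delta5 phi r z) with (g z).
    unfold recoveryK, u; fold k.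
    rewrite Series_ext with (b := fun n => (2 / L * g z * r ^ 3) * (k n * profile (k n) r * sin (k n * z)))
      by (intros; ring).
    rewrite Series_scal_l; change (fun n => freq L n) with k; unfold k; apply Rminus_diag_uniq; ring.
  + apply HI.
    * intros n z _; unfold u.
      apply (@continuous_scal_r R_UniformSpace R_AbsRing R_NormedModule).
      apply (@continuous_mult R_UniformSpace R_AbsRing); [apply continuous_sin_lin|apply Hg].
    * intros n z Hz; unfold u.
      assert (Hk : 0 <= k n) by now apply freq_nonneg.
      assert (Hp := profile_bounds (k n) r Hk ltac:(lra)).
      assert (Hkp : 0 <= k n * profile (k n) r) by (apply Rmult_le_pos; lra).
      assert (Hcoef : 0 <= 2 / L * (k n * profile (k n) r) * r ^ 3)
        by (apply Rmult_le_pos; [apply Rmult_le_pos|]; lra).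
      rewrite Rabs_mult, (Rabs_pos_eq (2 / L * _ * _)) by exact Hcoef.
      replace (2 / L * r ^ 3 * M * (k n * profile (k n) r))
        with (2 / L * (k n * profile (k n) r) * r ^ 3 * M) by ring.
      apply Rmult_le_compat_l; [exact Hcoef|].
      rewrite Rabs_mult; specialize (HM z Hz).
      generalize (sin_le_1 (k n * z)) (Rabs_pos (sin (k n * z))) (Rabs_pos (g z)); nra.
    * apply (@ex_series_scal R_AbsRing R_NormedModule (2 / L * r ^ 3 * M)).
      now apply ex_series_freq_profile.
- apply Series_ext; intros n.
  apply is_RInt_unique.
  assert (J2 : is_RInt (fun z => sin (k n * z) * dr (dr phi) r z) (- (L / 2)) (L / 2) (s2 n r))
    by (apply (@RInt_correct R_CompleteNormedModule); now apply ex_RInt_sin_coef).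
  assert (J1 : is_RInt (fun z => sin (k n * z) * dr phi r z) (- (L / 2)) (L / 2) (s1 n r))
    by (apply (@RInt_correct R_CompleteNormedModule); now apply ex_RInt_sin_coef).
  assert (J0 : is_RInt (fun z => sin (k n * z) * dz (dz phi) r z) (- (L / 2)) (L / 2)
     (- (k n ^ 2 * s n r))).
  { unfold k, s; rewrite <- sin_coef_dzdz by assumption.
    apply (@RInt_correct R_CompleteNormedModule); now apply ex_RInt_sin_coef. }
  assert (J := @is_RInt_plus R_NormedModule _ _ _ _ _ _
    (@is_RInt_plus R_NormedModule _ _ _ _ _ _ J2 (@is_RInt_scal R_NormedModule _ _ _ (3 / r) _ J1)) J0).
  assert (J' := @is_RInt_scal R_NormedModule _ _ _ (- (2 / L * (k n * profile (k n) r) * r ^ 3)) _ J).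
  evar_last.
  + apply is_RInt_ext with (2 := J'); intros z _.
    unfold u, g, plus, scal; simpl; unfold mult; simpl; ring.
  + unfold c, plus, scal; simpl; unfold mult; simpl; field; lra.
Qed.

(** The summed modes are bounded on [[0,1]], so cutting off the ends [(0,a)] and
    [(b,1)] costs at most a multiple of [a + (1 - b)]. *)
Lemma recoveryK_represents (G : R -> R -> R) :
  (forall r z, 0 < r < 1 -> - Delta5 phi r z = G r z) ->
  is_RInt_gen
    (fun r => RInt (fun z => recoveryK L r z * G r z * r ^ 3) (- (L / 2)) (L / 2))
    (at_right 0) (at_left 1) (Defs.sigma phi).
Proof.
intros HG.
destruct c_bound as [C HC].
assert (HexC : ex_series (fun n => C * / (INR n + 1) ^ 2)).
{ apply (@ex_series_scal R_AbsRing R_NormedModule C (fun n => / (INR n + 1) ^ 2)), ex_series_inv_sq. }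
assert (HI : is_RInt (fun r => Series (fun n => c n r)) 0 1 (Defs.sigma phi)).
{ rewrite <- wall_series.
  rewrite Series_ext with (b := fun n => RInt (c n) 0 1)
    by (intros n; symmetry; apply is_RInt_unique, is_RInt_c).
  apply is_RInt_Series with (fun n => C * / (INR n + 1) ^ 2); [lra| |exact HC|exact HexC].
  intros; apply continuous_c. }
set (S := fun r => Series (fun n => c n r)) in *.
set (M := Series (fun n => C * / (INR n + 1) ^ 2)).
assert (HM : forall r, 0 <= r <= 1 -> Rabs (S r) <= M).
{ intros r Hr; apply ex_series_dominated; [intros n; now apply HC|exact HexC]. }
assert (HM0 : 0 <= M) by (eapply Rle_trans; [apply Rabs_pos|apply (HM 0); lra]).
intros P [eps HP].
assert (Heps := cond_pos eps).
set (d := Rmin (1 / 2) (eps / (4 * (M + 1)))).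
assert (Hd : 0 < d) by (apply Rmin_pos; [lra|apply Rdiv_lt_0_compat; lra]).
assert (Hd1 : d <= 1 / 2) by apply Rmin_l.
assert (Hd2 : d * (4 * (M + 1)) <= eps).
{ apply <- Rle_div_r; [apply Rmin_r|lra]. }
exists (fun a => 0 < a < d) (fun b => 1 - d < b < 1).
- exists (mkposreal _ Hd); intros a Ha Hpos.
  unfold ball in Ha; simpl in Ha; unfold AbsRing_ball, abs, minus, plus, opp in Ha; simpl in Ha.
  apply Rabs_def2 in Ha; lra.
- exists (mkposreal _ Hd); intros b Hb Hlt.
  unfold ball in Hb; simpl in Hb; unfold AbsRing_ball, abs, minus, plus, opp in Hb; simpl in Hb.
  apply Rabs_def2 in Hb; lra.
- intros a b Ha Hb; simpl.
  assert (Hex01 : ex_RInt S 0 1) by (eexists; exact HI).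
  assert (Hexa1 : ex_RInt S a 1) by (apply (ex_RInt_Chasles_2 S 0 a 1); [lra|exact Hex01]).
  assert (Hex0a : ex_RInt S 0 a) by (apply (ex_RInt_Chasles_1 S 0 a 1); [lra|exact Hex01]).
  assert (Hexab : ex_RInt S a b) by (apply (ex_RInt_Chasles_1 S a b 1); [lra|exact Hexa1]).
  assert (Hexb1 : ex_RInt S b 1) by (apply (ex_RInt_Chasles_2 S a b 1); [lra|exact Hexa1]).
  exists (RInt S a b); split.
  + apply is_RInt_ext with S.
    * intros r; rewrite Rmin_left, Rmax_right by lra; intros Hr.
      symmetry; apply inner_integral; [exact HG|lra].
    * now apply (@RInt_correct R_CompleteNormedModule).
  + apply HP.
    assert (E1 := RInt_Chasles S 0 a 1 Hex0a Hexa1).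
    assert (E2 := RInt_Chasles S a b 1 Hexab Hexb1).
    rewrite (is_RInt_unique _ _ _ _ HI), <- E2 in E1.
    unfold plus in E1; simpl in E1.
    assert (B1 : Rabs (RInt S 0 a) <= (a - 0) * M)
      by (apply abs_RInt_le_const; [lra|exact Hex0a|intros; apply HM; lra]).
    assert (B2 : Rabs (RInt S b 1) <= (1 - b) * M)
      by (apply abs_RInt_le_const; [lra|exact Hexb1|intros; apply HM; lra]).
    unfold ball; simpl; unfold AbsRing_ball, abs, minus, plus, opp; simpl.
    rewrite <- E1.
    assert ((a - 0) * M <= d * M) by (apply Rmult_le_compat_r; lra).
    assert ((1 - b) * M <= d * M) by (apply Rmult_le_compat_r; lra).
    apply Rabs_le_between in B1; apply Rabs_le_between in B2.
    apply Rabs_def1; nra.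
Qed.

End Solution.

Theorem recoveryK_is_kernel L : 0 < L -> recovery_kernel L (recoveryK L).
Proof.
intros HL; split; [|split].
- intros r z Hr; now apply recoveryK_continuity.
- intros r z _; now apply recoveryK_periodic.
- intros phi G [Hs [_ [Hp [Hw HG]]]].
  now apply recoveryK_represents.
Qed.

(** * Explicit solutions of the Dirichlet problem *)

Definition bump (al ga t : R) : R := flat 0 (t - al) * flat 0 (ga - t).

Lemma Ck_bump n al ga : Ck n (bump al ga).
Proof.
apply Ck_mult.
- apply (Ck_comp n (flat 0) (fun t => t - al)); [apply Ck_flat|].
  apply Ck_plus; [apply Ck_id|apply Ck_const].
- apply (Ck_comp n (flat 0) (fun t => ga - t)); [apply Ck_flat|].
  apply (Ck_plus n (fun _ => ga) (fun t => - t)); [apply Ck_const|].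
  apply Ck_ext with (fun t => (-1) * t); [intros; ring|apply Ck_scal, Ck_id].
Qed.

Lemma bump_pos al ga t : al < t < ga -> 0 < bump al ga t.
Proof. intros H; apply Rmult_lt_0_compat; apply flat0_pos; lra. Qed.

Lemma bump_left al ga t : t <= al -> bump al ga t = 0.
Proof. intros H; unfold bump; rewrite flat_neg by lra; ring. Qed.

Lemma bump_right al ga t : ga <= t -> bump al ga t = 0.
Proof. intros H; unfold bump; rewrite (flat_neg 0 (ga - t)) by lra; ring. Qed.

(** In the variable [t = r^2] the radial operator [s'' + 3 s'/r - k^2 s] reads
    [4 t S'' + 8 S' - k^2 S]; [modeU] solves the homogeneous equation. *)
Definition modeU (k t : R) : R := besselF (k ^ 2 / 4 * t).

Lemma Ck_modeU n k : Ck n (modeU k).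
Proof.
apply (Ck_comp n besselF (fun t => k ^ 2 / 4 * t)); [apply Ck_besselF|apply Ck_scal, Ck_id].
Qed.

Lemma modeU_ge_1 k t : 0 <= t -> 1 <= modeU k t.
Proof. intros Ht; apply besselF_ge_1; nra. Qed.

Lemma modeU_ode k t : exists U1 : R -> R, exists U2,
  (forall t, is_derive (modeU k) t (U1 t)) /\ is_derive U1 t U2 /\
  4 * t * U2 + 8 * U1 t = k ^ 2 * modeU k t.
Proof.
destruct (besselF_ode (k ^ 2 / 4 * t)) as [F2 [HF E]].
exists (fun t => k ^ 2 / 4 * besselF1 (k ^ 2 / 4 * t)), (k ^ 2 / 4 * (k ^ 2 / 4 * F2)).
assert (Hlin : forall t, is_derive (fun t => k ^ 2 / 4 * t) t (k ^ 2 / 4)).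
{ intros u; auto_derive; [easy|field]. }
split; [|split].
- intros u; evar_last.
  + apply (is_derive_comp besselF (fun t => k ^ 2 / 4 * t)); [apply is_derive_besselF|apply Hlin].
  + unfold scal; simpl; unfold mult; simpl; ring.
- apply is_derive_scal; evar_last.
  + apply (is_derive_comp besselF1 (fun t => k ^ 2 / 4 * t)); [exact HF|apply Hlin].
  + unfold scal; simpl; unfold mult; simpl; ring.
- unfold modeU; rewrite <- E; field.
Qed.

(** Variation of constants.  The solution of
    [4 t S'' + 8 S' - k^2 S = - 4 h / (t U)] is sought as [S = U W], which
    turns the equation into [(t^2 U^2 W')' = - h].  Here [Q] is the primitive of
    the bump [h] and [om] is [- W'], that is [Q / (t^2 U^2)].  The flat function
    added to the denominator lives where [Q] vanishes: it leaves the quotient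
    unchanged and keeps the denominator positive on the whole line, including
    [t = 0] and the negative axis, where [U] may vanish. *)
Section RadialTest.
Variables (k al ga : R).
Hypothesis Hal : 0 < al.

Let U := modeU k.
Let h := bump al ga.
Let Q (t : R) : R := RInt h 0 t.
Let den (t : R) : R := t ^ 2 * U t ^ 2 + flat 0 (al - t).
Let om (t : R) : R := Q t * / den t.
Definition radial_test (t : R) : R := modeU k t * - RInt om 1 t.

Lemma den_pos t : 0 < den t.
Proof.
unfold den.
assert (H1 := flat0_nonneg (al - t)).
assert (H2 : 0 <= t ^ 2 * U t ^ 2) by (apply Rmult_le_pos; apply pow2_ge_0).
destruct (Rlt_dec t al) as [H|H].
- assert (0 < flat 0 (al - t)) by (apply flat0_pos; lra); lra.
- assert (0 < t ^ 2 * U t ^ 2); [|lra].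
  assert (1 <= U t) by (apply modeU_ge_1; lra).
  apply Rmult_lt_0_compat; apply pow_lt; lra.
Qed.

Lemma Ck_om n : Ck n om.
Proof.
apply Ck_mult.
- apply Ck_pred, Ck_primitive, Ck_bump.
- apply Ck_inv; [intros t; generalize (den_pos t); lra|].
  apply Ck_plus.
  + apply Ck_mult; apply Ck_pow; [apply Ck_id|apply Ck_modeU].
  + apply (Ck_comp n (flat 0) (fun t => al - t)); [apply Ck_flat|].
    apply (Ck_plus n (fun _ => al) (fun t => - t)); [apply Ck_const|].
    apply Ck_ext with (fun t => (-1) * t); [intros; ring|apply Ck_scal, Ck_id].
Qed.

Lemma Ck_radial_test n : Ck n radial_test.
Proof.
apply Ck_mult; [apply Ck_modeU|].
apply Ck_ext with (fun t => (-1) * RInt om 1 t); [intros; ring|].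
apply Ck_scal, Ck_pred, Ck_primitive, Ck_om.
Qed.

Lemma radial_test_1 : radial_test 1 = 0.
Proof.
unfold radial_test; rewrite RInt_point; unfold zero; simpl; ring.
Qed.

Lemma om_eq t : t ^ 2 * U t ^ 2 * om t = Q t.
Proof.
unfold om.
destruct (Rlt_dec t al) as [H|H].
- assert (E : Q t = 0); [|rewrite E; ring].
  unfold Q; rewrite RInt_ext with (g := fun _ => 0).
  + rewrite RInt_const; unfold scal; simpl; unfold mult; simpl; ring.
  + intros x Hx; apply bump_left.
    assert (Rmax 0 t <= al) by (apply Rmax_lub; lra); lra.
- assert (Hd := den_pos t); unfold den in *.
  rewrite (flat_neg 0 (al - t)) in * by lra.
  rewrite Rplus_0_r in *; field.
  split; intros E; rewrite E in Hd; simpl in Hd; lra.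
Qed.

Lemma radial_test_ode t : 0 < t -> exists S1 : R -> R, exists S2,
  (forall t, is_derive radial_test t (S1 t)) /\ is_derive S1 t S2 /\
  4 * t * S2 + 8 * S1 t - k ^ 2 * radial_test t = - (4 * h t / (t * U t)).
Proof.
intros Ht.
destruct (modeU_ode k t) as [U1 [U2 [HU1 [HU2 E]]]].
destruct (Ck_om 1) as [om' [Hom _]].
set (W := fun t => - RInt om 1 t).
assert (HW : forall t, is_derive W t (- om t)).
{ intros u; apply (@is_derive_opp R_AbsRing R_NormedModule).
  apply (is_derive_RInt om _ 1 u).
  - apply filter_forall; intros y; apply (@RInt_correct R_CompleteNormedModule).
    apply (@ex_RInt_continuous R_CompleteNormedModule); intros; apply (Ck_continuous 0), Ck_om.
  - apply (Ck_continuous 0), Ck_om. }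
exists (fun t => U1 t * W t + U t * - om t),
  (U2 * W t + U1 t * - om t + (U1 t * - om t + U t * - om' t)).
split; [|split].
- intros u; apply (is_derive_mult (modeU k) W); [apply HU1|apply HW|apply Rmult_comm].
- apply (@is_derive_plus R_AbsRing R_NormedModule).
  + apply (is_derive_mult U1 W); [exact HU2|apply HW|apply Rmult_comm].
  + apply (is_derive_mult (modeU k) (fun t => - om t)); [apply HU1| |apply Rmult_comm].
    apply (@is_derive_opp R_AbsRing R_NormedModule), Hom.
- assert (HQ : is_derive Q t (h t)).
  { apply (is_derive_RInt h _ 0 t).
    - apply filter_forall; intros y; apply (@RInt_correct R_CompleteNormedModule).
      apply (@ex_RInt_continuous R_CompleteNormedModule); intros; apply (Ck_continuous 0), Ck_bump.
    - apply (Ck_continuous 0), Ck_bump. }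
  assert (HQ2 : is_derive Q t (2 * t * U t ^ 2 * om t + 2 * t ^ 2 * U t * U1 t * om t + t ^ 2 * U t ^ 2 * om' t)).
  { apply (is_derive_ext (fun t => t ^ 2 * U t ^ 2 * om t)); [apply om_eq|].
    evar_last.
    - apply (is_derive_mult (fun t => t ^ 2 * U t ^ 2) om); [|apply Hom|apply Rmult_comm].
      apply (is_derive_mult (fun t => t ^ 2) (fun t => U t ^ 2)); [| |apply Rmult_comm].
      + apply is_derive_pow, (@is_derive_id R_AbsRing).
      + apply is_derive_pow, HU1.
    - unfold plus, mult, one; simpl; ring. }
  assert (Eh : h t = 2 * t * U t ^ 2 * om t + 2 * t ^ 2 * U t * U1 t * om t + t ^ 2 * U t ^ 2 * om' t).
  { rewrite <- (is_derive_unique _ _ _ HQ); now apply is_derive_unique. }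
  unfold radial_test; fold (W t); rewrite Eh.
  assert (HUp : 1 <= U t) by (apply modeU_ge_1; lra).
  fold (U t) in *; unfold U in E; fold (U t) in E.
  replace (4 * t * (U2 * W t + U1 t * - om t + (U1 t * - om t + U t * - om' t)) +
     8 * (U1 t * W t + U t * - om t) - k ^ 2 * (U t * W t))
   with (W t * (4 * t * U2 + 8 * U1 t - k ^ 2 * U t) - 8 * t * U1 t * om t - 4 * t * U t * om' t - 8 * U t * om t)
   by ring.
  rewrite E; field; lra.
Qed.

End RadialTest.

Definition angular_test (L z0 : R) (n : nat) (z : R) : R :=
  cos (INR n * (2 * PI / L * (z - z0))).

(** Separated solutions of the Dirichlet problem: a function of [r^2] times a
    shifted cosine mode, with right-hand side supported in the shell
    [al <= r^2 <= ga]. *)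
Definition test_phi (L al ga z0 : R) (n : nat) (r z : R) : R :=
  radial_test (freq L n) al ga (r ^ 2) * angular_test L z0 n z.
Definition test_G (L al ga z0 : R) (n : nat) (r z : R) : R :=
  4 * bump al ga (r ^ 2) / (r ^ 2 * modeU (freq L n) (r ^ 2)) * angular_test L z0 n z.

Lemma Ck_angular_test L z0 n m : Ck m (angular_test L z0 n).
Proof.
apply (Ck_comp m cos (fun z => INR n * (2 * PI / L * (z - z0)))); [apply Ck_cos_sin|].
apply Ck_scal, Ck_scal, Ck_plus; [apply Ck_id|apply Ck_const].
Qed.

Lemma test_solution L al ga z0 n : 0 < L -> 0 < al ->
  dirichlet_solution L (test_phi L al ga z0 n) (test_G L al ga z0 n).
Proof.
intros HL Hal; unfold test_phi, test_G; split; [|split; [|split; [|split]]].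
- apply (smooth2_tensor (fun r => radial_test (freq L n) al ga (r ^ 2)));
    [|intros m; apply Ck_angular_test].
  intros m; apply (Ck_comp m (radial_test _ al ga) (fun r => r ^ 2));
    [now apply Ck_radial_test|apply Ck_pow, Ck_id].
- intros r z; do 2 f_equal; ring.
- intros r z; f_equal; unfold angular_test.
  replace (INR n * (2 * PI / L * (z + L - z0)))
    with (INR n * (2 * PI / L * (z - z0)) + 2 * INR n * PI) by (field; lra).
  apply cos_period.
- intros z; replace (1 ^ 2) with 1 by ring; rewrite radial_test_1; ring.
- intros r z Hr.
  set (k := freq L n).
  assert (Ht : 0 < r ^ 2) by (apply pow_lt; lra).
  destruct (radial_test_ode k al ga Hal (r ^ 2) Ht) as [S1 [S2 [H1 [H2 E]]]].
  assert (Hsq : forall u, is_derive (fun r => r ^ 2) u (2 * u)).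
  { intros u; auto_derive; [easy|ring]. }
  assert (D1 : forall u, is_derive (fun u => radial_test k al ga (u ^ 2) * angular_test L z0 n z) u
     (angular_test L z0 n z * (2 * u * S1 (u ^ 2)))).
  { intros u; evar_last.
    - apply (is_derive_ext (fun u => angular_test L z0 n z * radial_test k al ga (u ^ 2))); [intros; apply Rmult_comm|].
      apply is_derive_scal.
      apply (is_derive_comp (radial_test k al ga) (fun r => r ^ 2)); [apply H1|apply Hsq].
    - reflexivity. }
  assert (D2 : is_derive (fun u => angular_test L z0 n z * (2 * u * S1 (u ^ 2))) r
     (angular_test L z0 n z * (2 * S1 (r ^ 2) + 4 * r ^ 2 * S2))).
  { apply is_derive_scal; evar_last.
    - apply (is_derive_mult (fun u => 2 * u) (fun u => S1 (u ^ 2))).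
      + auto_derive; [easy|reflexivity].
      + apply (is_derive_comp S1 (fun r => r ^ 2)); [exact H2|apply Hsq].
      + apply Rmult_comm.
    - unfold plus, mult, scal; simpl; unfold mult; simpl; ring. }
  assert (A1 : forall v, is_derive (angular_test L z0 n) v (- k * sin (INR n * (2 * PI / L * (v - z0))))).
  { intros v; unfold angular_test; auto_derive; [easy|].
    change (v + - z0) with (v - z0); unfold k, freq.
    change (2 * PI * / L) with (2 * PI / L); ring. }
  assert (A2 : is_derive (fun v => - k * sin (INR n * (2 * PI / L * (v - z0)))) z (- k ^ 2 * angular_test L z0 n z)).
  { unfold angular_test; auto_derive; [easy|].
    change (z + - z0) with (z - z0); unfold k, freq.
    change (2 * PI * / L) with (2 * PI / L); ring. }
  fold k.
  set (f := fun r z => radial_test k al ga (r ^ 2) * angular_test L z0 n z).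
  assert (E10 : partial_derive 1 0 f r z = angular_test L z0 n z * (2 * r * S1 (r ^ 2)))
    by apply is_derive_unique, D1.
  assert (E20 : partial_derive 2 0 f r z = angular_test L z0 n z * (2 * S1 (r ^ 2) + 4 * r ^ 2 * S2)).
  { transitivity (Derive (fun u => angular_test L z0 n z * (2 * u * S1 (u ^ 2))) r);
      [|apply is_derive_unique, D2].
    apply Derive_ext; intros u; apply is_derive_unique, D1. }
  assert (E02 : partial_derive 0 2 f r z = radial_test k al ga (r ^ 2) * (- k ^ 2 * angular_test L z0 n z)).
  { transitivity (Derive (fun v => radial_test k al ga (r ^ 2) * (- k * sin (INR n * (2 * PI / L * (v - z0))))) z);
      [|apply is_derive_unique, is_derive_scal, A2].
    apply Derive_ext; intros v; apply is_derive_unique, is_derive_scal, A1. }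
  unfold Delta5; rewrite E10, E20, E02.
  replace (4 * bump al ga (r ^ 2) / (r ^ 2 * modeU k (r ^ 2)))
    with (- (4 * r ^ 2 * S2 + 8 * S1 (r ^ 2) - k ^ 2 * radial_test k al ga (r ^ 2)))
    by (rewrite E; ring).
  field; lra.
Qed.

(** * Uniqueness of the kernel and the local expansion *)

Definition test_weight (L al ga : R) (n : nat) (r : R) : R :=
  4 * r * bump al ga (r ^ 2) / modeU (freq L n) (r ^ 2).

Lemma continuous_test_weight L al ga n r : continuous (test_weight L al ga n) r.
Proof.
apply (@continuous_mult R_UniformSpace R_AbsRing (fun r => 4 * r * bump al ga (r ^ 2))
         (fun r => / modeU (freq L n) (r ^ 2))).
- apply (Ck_continuous 0 (fun r => 4 * r * bump al ga (r ^ 2))), Ck_mult.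
  + apply Ck_scal, Ck_id.
  + apply (Ck_comp 0 (bump al ga) (fun r => r ^ 2)); [apply Ck_bump|apply Ck_pow, Ck_id].
- apply (Ck_continuous 0 (fun r => / modeU (freq L n) (r ^ 2))).
  apply (Ck_inv 0 (fun r => modeU (freq L n) (r ^ 2))).
  + intros x; generalize (modeU_ge_1 (freq L n) (x ^ 2) (pow2_ge_0 x)); lra.
  + apply (Ck_comp 0 (modeU (freq L n)) (fun r => r ^ 2)); [apply Ck_modeU|apply Ck_pow, Ck_id].
Qed.

Lemma continuous_cos_coef_param L K z0 n r : 0 < L -> 0 < r < 1 ->
  (forall r z, 0 < r < 1 -> continuity_2d_pt K r z) ->
  continuous (fun r => cos_coef L (K r) z0 n) r.
Proof.
intros HL Hr HK.
apply (continuous_RInt_param (fun r z => K r z * cos (INR n * (2 * PI / L * (z - z0))))); [lra|].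
assert (Hd : 0 < Rmin r (1 - r)) by (apply Rmin_pos; lra).
exists (mkposreal _ Hd); intros u Hu t.
unfold ball in Hu; simpl in Hu; unfold AbsRing_ball, abs, minus, plus, opp in Hu; simpl in Hu.
assert (A1 := Rlt_le_trans _ _ _ Hu (Rmin_l _ _)).
assert (A2 := Rlt_le_trans _ _ _ Hu (Rmin_r _ _)).
apply Rabs_def2 in A1; apply Rabs_def2 in A2.
apply continuity_2d_pt_mult; [apply HK; lra|].
apply (continuity_1d_2d_pt_comp (angular_test L z0 n) (fun _ v => v)); [|apply continuity_2d_pt_id2].
apply continuity_pt_filterlim, (Ck_continuous 0), Ck_angular_test.
Qed.

(** Since the right-hand side is supported away from the axis and from the wall,
    the improper pairing is a proper integral over [[a,b]]. *)
Lemma test_pairing L K z0 n a b : 0 < L -> 0 < a -> a < b -> b < 1 ->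
  recovery_kernel L K ->
  RInt (fun r => test_weight L (a ^ 2) (b ^ 2) n r * cos_coef L (K r) z0 n) a b
  = Defs.sigma (test_phi L (a ^ 2) (b ^ 2) z0 n).
Proof.
intros HL Ha Hab Hb [HK [_ Hrep]].
assert (Hrep1 := Hrep _ _ (test_solution L (a ^ 2) (b ^ 2) z0 n HL (pow_lt a 2 Ha))).
set (w := test_weight L (a ^ 2) (b ^ 2) n).
set (F := fun r => RInt (fun z => K r z * test_G L (a ^ 2) (b ^ 2) z0 n r z * r ^ 3) (- (L / 2)) (L / 2)) in *.
assert (HF : forall r, 0 < r < 1 -> F r = w r * cos_coef L (K r) z0 n).
{ intros r Hr; unfold F, cos_coef.
  rewrite <- (RInt_scal (fun z => K r z * cos (INR n * (2 * PI / L * (z - z0))))).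
  - apply RInt_ext; intros z _.
    change (K r z * test_G L (a ^ 2) (b ^ 2) z0 n r z * r ^ 3
            = w r * (K r z * cos (INR n * (2 * PI / L * (z - z0))))).
    unfold test_G, w, test_weight, angular_test.
    assert (H := modeU_ge_1 (freq L n) (r ^ 2) (pow2_ge_0 r)); field; lra.
  - apply (@ex_RInt_continuous R_CompleteNormedModule); intros z _.
    apply continuous_cos_coef_integrand, (continuous_of_2d K), HK, Hr. }
assert (Hw0 : forall r, 0 < r <= a \/ b <= r -> w r = 0).
{ intros r Hr; unfold w, test_weight.
  assert (E : bump (a ^ 2) (b ^ 2) (r ^ 2) = 0).
  { destruct Hr; [apply bump_left|apply bump_right]; apply pow_incr; lra. }
  rewrite E; unfold Rdiv; ring. }
assert (Hmid : is_RInt F a b (RInt (fun r => w r * cos_coef L (K r) z0 n) a b)).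
{ apply is_RInt_ext with (fun r => w r * cos_coef L (K r) z0 n).
  - intros r; rewrite Rmin_left, Rmax_right by lra; intros Hr; symmetry; apply HF; lra.
  - apply (@RInt_correct R_CompleteNormedModule), (@ex_RInt_continuous R_CompleteNormedModule).
    intros r; rewrite Rmin_left, Rmax_right by lra; intros Hr.
    apply (@continuous_mult R_UniformSpace R_AbsRing); [apply continuous_test_weight|].
    apply continuous_cos_coef_param; [exact HL|lra|exact HK]. }
set (v := RInt (fun r => w r * cos_coef L (K r) z0 n) a b) in *.
assert (Hgen : is_RInt_gen F (at_right 0) (at_left 1) v).
{ intros P HP.
  exists (fun x => 0 < x < a) (fun y => b < y < 1).
  - exists (mkposreal _ Ha); intros x Hx Hpos.
    unfold ball in Hx; simpl in Hx; unfold AbsRing_ball, abs, minus, plus, opp in Hx; simpl in Hx.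
    apply Rabs_def2 in Hx; lra.
  - assert (Hb1 : 0 < 1 - b) by lra.
    exists (mkposreal _ Hb1); intros y Hy Hlt.
    unfold ball in Hy; simpl in Hy; unfold AbsRing_ball, abs, minus, plus, opp in Hy; simpl in Hy.
    apply Rabs_def2 in Hy; lra.
  - intros x y Hx Hy; simpl.
    exists v; split; [|now apply locally_singleton].
    assert (Hzero : forall c d, c <= d -> 0 < c -> d < 1 -> (d <= a \/ b <= c) -> is_RInt F c d 0).
    { intros c d Hcd Hc Hd Hout; apply is_RInt_ext with (fun _ => 0).
      - intros r; rewrite Rmin_left, Rmax_right by lra; intros Hr.
        rewrite HF by lra; rewrite Hw0 by lra; symmetry; apply Rmult_0_l.
      - evar_last; [apply (@is_RInt_const R_NormedModule)|].
        unfold scal; simpl; unfold mult; simpl; ring. }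
    evar_last.
    + apply (is_RInt_Chasles F x b y).
      * apply (is_RInt_Chasles F x a b); [apply Hzero; lra|exact Hmid].
      * apply Hzero; lra.
    + unfold plus; simpl; ring. }
rewrite <- (is_RInt_gen_unique F _ Hgen).
now apply is_RInt_gen_unique.
Qed.

(** Two kernels pair equally with every shell, and the weight is positive inside
    the shell; a shell around [r] on which one coefficient exceeds the other
    would contradict this. *)
Lemma cos_coef_le L K1 K2 z0 n r : 0 < L -> 0 < r < 1 ->
  recovery_kernel L K1 -> recovery_kernel L K2 ->
  cos_coef L (K1 r) z0 n <= cos_coef L (K2 r) z0 n.
Proof.
intros HL Hr HK1 HK2.
destruct (Rle_dec (cos_coef L (K1 r) z0 n) (cos_coef L (K2 r) z0 n)) as [|Hlt]; [easy|exfalso].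
set (D := fun r => cos_coef L (K1 r) z0 n - cos_coef L (K2 r) z0 n).
assert (HD : forall r, 0 < r < 1 -> continuous D r).
{ intros u Hu; apply (@continuous_minus R_UniformSpace R_AbsRing R_NormedModule);
    apply continuous_cos_coef_param; try assumption; [apply HK1|apply HK2]. }
assert (Hpos : 0 < D r) by (unfold D; lra).
destruct (proj2 (continuity_pt_filterlim _ _) (HD r Hr) (D r) Hpos) as [d0 [Hd0 Hd]].
set (d := Rmin (d0 / 2) (Rmin (r / 2) ((1 - r) / 2))).
assert (L1 : d <= d0 / 2) by apply Rmin_l.
assert (L2 : d <= r / 2) by (eapply Rle_trans; [apply Rmin_r|apply Rmin_l]).
assert (L3 : d <= (1 - r) / 2) by (eapply Rle_trans; [apply Rmin_r|apply Rmin_r]).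
assert (Hdp : 0 < d) by (repeat apply Rmin_pos; lra).
set (a := r - d); set (b := r + d).
assert (Ha : 0 < a) by (unfold a; lra).
assert (Hab : a < b) by (unfold a, b; lra).
assert (Hb : b < 1) by (unfold b; lra).
assert (T1 := test_pairing L K1 z0 n a b HL Ha Hab Hb HK1).
assert (T2 := test_pairing L K2 z0 n a b HL Ha Hab Hb HK2).
set (w := test_weight L (a ^ 2) (b ^ 2) n) in *.
assert (Hex : forall K, recovery_kernel L K -> ex_RInt (fun r => w r * cos_coef L (K r) z0 n) a b).
{ intros K HK; apply (@ex_RInt_continuous R_CompleteNormedModule).
  intros u; rewrite Rmin_left, Rmax_right by lra; intros Hu.
  apply (@continuous_mult R_UniformSpace R_AbsRing); [apply continuous_test_weight|].
  apply continuous_cos_coef_param; [exact HL|lra|apply HK]. }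
assert (E : RInt (fun r => w r * D r) a b = 0).
{ rewrite RInt_ext with (g := fun r => minus (w r * cos_coef L (K1 r) z0 n) (w r * cos_coef L (K2 r) z0 n)).
  - rewrite (RInt_minus (fun r => w r * cos_coef L (K1 r) z0 n)) by (now apply Hex).
    rewrite T1, T2; unfold minus, plus, opp; simpl; ring.
  - intros u _; unfold D, minus, plus, opp; simpl; ring. }
assert (P : 0 < RInt (fun r => w r * D r) a b); [|lra].
apply RInt_gt_0; [exact Hab| |].
- intros u Hu; apply Rmult_lt_0_compat.
  + unfold w, test_weight.
    assert (H := modeU_ge_1 (freq L n) (u ^ 2) (pow2_ge_0 u)).
    apply Rdiv_lt_0_compat; [|lra].
    apply Rmult_lt_0_compat; [lra|]; apply bump_pos; simpl; nra.
  + destruct (Req_dec u r) as [->|Hne]; [exact Hpos|].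
    assert (Hud : Rabs (D u - D r) < D r).
    { apply (Hd u); split; [split; [exact I|auto]|].
      unfold dist; simpl; unfold R_dist; apply Rabs_def1; unfold a, b in Hu; lra. }
    apply Rabs_def2 in Hud; lra.
- intros u Hu; apply (@continuous_mult R_UniformSpace R_AbsRing);
    [apply continuous_test_weight|apply HD; lra].
Qed.

(** For fixed [r] the difference of the kernels is continuous in [z] and all its
    cosine coefficients about the point [z] itself vanish. *)
Lemma recovery_kernel_unique L K1 K2 r z : 0 < L -> 0 < r < 1 -> Rabs z < L / 2 ->
  recovery_kernel L K1 -> recovery_kernel L K2 -> K1 r z = K2 r z.
Proof.
intros HL Hr Hz HK1 HK2.
assert (C1 : forall t, continuous (K1 r) t) by (intros t; apply (continuous_of_2d K1), HK1, Hr).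
assert (C2 : forall t, continuous (K2 r) t) by (intros t; apply (continuous_of_2d K2), HK2, Hr).
apply Rminus_diag_uniq.
apply (fourier_unique L (fun z => K1 r z - K2 r z) z HL Hz).
{ intros t _; apply (@continuous_minus R_UniformSpace R_AbsRing R_NormedModule); auto. }
intros n.
transitivity (cos_coef L (K1 r) z n - cos_coef L (K2 r) z n).
- unfold cos_coef.
  rewrite RInt_ext with (g := fun t => minus (K1 r t * cos (INR n * (2 * PI / L * (t - z))))
                                           (K2 r t * cos (INR n * (2 * PI / L * (t - z))))).
  + apply (RInt_minus (fun t => K1 r t * cos (INR n * (2 * PI / L * (t - z)))));
      apply (@ex_RInt_continuous R_CompleteNormedModule); intros t _;
      now apply continuous_cos_coef_integrand.
  + intros t _; unfold minus, plus, opp; simpl; ring.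
- generalize (cos_coef_le L K1 K2 z n r HL Hr HK1 HK2) (cos_coef_le L K2 K1 z n r HL Hr HK2 HK1); lra.
Qed.

Theorem theorem4p1 (L : R) (HL : 0 < L) :
  (exists K : R -> R -> R, recovery_kernel L K) /\
  (forall K : R -> R -> R, recovery_kernel L K ->
    exists (C0 lam0 : R) (Krem Ksmooth : R -> R -> R -> R),
      0 < C0 /\ 0 < lam0 /\
      (forall lam x y, 0 < lam < lam0 -> packet lam x y ->
         K (1 - x) y = C0 * (x * y / (x ^ 2 + y ^ 2) ^ 2) + Krem lam x y) /\
      (forall lam, 0 < lam < lam0 -> smooth2 (Ksmooth lam)) /\
      (forall i j : nat, exists B : R,
         forall lam x y, 0 < lam < lam0 -> packet lam x y ->
           Rabs (partial_derive i j (Ksmooth lam) x y) <= B) /\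
      (forall m M : R, 0 < m -> m < M -> exists C : R,
         forall lam x y, 0 < lam < lam0 -> packet lam x y ->
           m * x <= Rabs y <= M * x ->
           Rabs (Krem lam x y)
             <= C * lam * (Rabs (x * y) / (x ^ 2 + y ^ 2) ^ 2)
                + Ksmooth lam x y)).
Proof.
split; [exists (recoveryK L); now apply recoveryK_is_kernel|].
intros K HK.
assert (HPI := PI_RGT_0).
assert (Hk := two_PI_div_pos L HL); set (k := 2 * PI / L) in *.
set (lam0 := Rmin (1 / 2) (Rmin (/ k) (L / 2))).
exists (2 / PI), lam0,
  (fun _ x y => K (1 - x) y - 2 / PI * (x * y / (x ^ 2 + y ^ 2) ^ 2)),
  (fun _ _ _ => 0).
assert (Hl0 : 0 < lam0).
{ repeat apply Rmin_pos; try lra; now apply Rinv_0_lt_compat. }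
assert (Hl1 : lam0 <= 1 / 2) by apply Rmin_l.
assert (Hl2 : lam0 <= / k) by (eapply Rle_trans; [apply Rmin_r|apply Rmin_l]).
assert (Hl3 : lam0 <= L / 2) by (eapply Rle_trans; [apply Rmin_r|apply Rmin_r]).
split; [apply Rdiv_lt_0_compat; lra|].
split; [exact Hl0|].
split; [intros; ring|].
split.
{ intros lam _ n x y.
  apply ex_diff_n_ext_loc with (fun _ _ => 0 * 0).
  - apply locally_2d_forall; intros; ring.
  - apply (ex_diff_n_tensor n (fun _ => 0) (fun _ => 0)); apply Ck_const. }
split.
{ intros i j; exists 0; intros lam x y _ _; unfold partial_derive.
  rewrite (Derive_n_ext _ (fun _ => 0)).
  - destruct i; [simpl|rewrite Derive_n_const]; rewrite Rabs_R0; lra.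
  - intros t; destruct j; [reflexivity|apply Derive_n_const]. }
intros m M Hm HmM.
destruct (recoveryK_expansion L HL) as [C [HC Hexp]].
exists (C * ((1 + M ^ 2) ^ 2 / m)); intros lam x y Hlam [Hx Hy] Hcone.
rewrite (recovery_kernel_unique L K (recoveryK L) (1 - x) y HL) by
  (try exact HK; try (now apply recoveryK_is_kernel); lra).
assert (Hkx : forall t, t < / k -> k * t <= 1).
{ intros t Ht; apply Rle_trans with (k * / k); [apply Rmult_le_compat_l; lra|right; field; lra]. }
eapply Rle_trans.
{ apply Hexp; [lra|apply Hkx; lra|].
  rewrite Rabs_mult, (Rabs_pos_eq (2 * PI / L)) by (fold k; lra); apply Hkx; lra. }
rewrite Rplus_0_r.
(* On the cone [x^2 + y^2] and [|x y|] are comparable to [x^2], and [x < lam]: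
   so [1/x] is at most a constant times [lam |x y| / (x^2 + y^2)^2]. *)
assert (Hy2 : y ^ 2 <= M ^ 2 * x ^ 2).
{ rewrite <- (pow2_abs y), <- Rpow_mult_distr; apply pow_incr; split; [apply Rabs_pos|lra]. }
assert (Hx2 : 0 < x ^ 2) by (apply pow_lt; lra).
assert (Hrho : 0 < x ^ 2 + y ^ 2 <= (1 + M ^ 2) * x ^ 2) by (generalize (pow2_ge_0 y); lra).
assert (HM2 : 0 < (1 + M ^ 2) ^ 2) by (apply pow_lt; generalize (pow2_ge_0 M); lra).
unfold Rdiv at 1; rewrite !Rmult_assoc; apply Rmult_le_compat_l; [exact HC|].
rewrite Rabs_mult, (Rabs_pos_eq x) by lra.
apply Rle_trans with ((1 + M ^ 2) ^ 2 / m * (x * (x * (m * x) / ((1 + M ^ 2) * x ^ 2) ^ 2))).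
- right; field; repeat split; try lra; generalize (pow2_ge_0 M); lra.
- apply Rmult_le_compat_l; [left; apply Rdiv_lt_0_compat; lra|].
  assert (Hrho2 : 0 < (x ^ 2 + y ^ 2) ^ 2) by (apply pow_lt; lra).
  apply Rmult_le_compat; [lra| |lra|].
  + apply Rmult_le_pos; [apply Rmult_le_pos; [lra|apply Rmult_le_pos; lra]|].
    left; apply Rinv_0_lt_compat, pow_lt; lra.
  + apply Rmult_le_compat; [apply Rmult_le_pos; [lra|apply Rmult_le_pos; lra]| | |].
    * left; apply Rinv_0_lt_compat, pow_lt; lra.
    * apply Rmult_le_compat_l; lra.
    * apply Rinv_le_contravar; [exact Hrho2|apply pow_incr; lra].
Qed.
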